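(* Let $\mathbf R=(R_0,R_1,\dots)$ be an exponential Dowling structure (for a group of order $s$) with denominator sequence $(N(0),N(1),\dots)$ and associated exponential structure $\mathbf Q=(Q_1,Q_2,\dots)$ with denominator sequence $(M(1),M(2),\dots)$. Let $I\subseteq\mathbb P$ and $J\subseteq\mathbb N$. Then, as formal power series, $$\sum_{b\in J}\mu_{I,J}(b)\frac{x^b}{N(b)\,b!}=\frac{-\sum_{n\ge0}\frac{x^n}{N(n)\,n!}+\sum_{n\in\mathbb N\setminus J}p_n\frac{x^n}{N(n)\,n!}}{\Big(\sum_{n\ge0}\frac{(s x)^n}{M(n)\,n!}-\sum_{n\in\mathbb P\setminus I}m_n\frac{(s x)^n}{M(n)\,n!}\Big)^{1/s}}.$$
   Context: $\mathbb P$ = positive integers, $\mathbb N$ = nonnegative integers; convention $M(0)=1$. Dowling lattice: fix a finite group $G$ of order $s$. For $n\ge0$, $L_n$ has as elements pairs $(\tilde\pi,Z)$ with $Z\subseteq\{1,\dots,n\}$ (zero block) and $\tilde\pi$ a set partition of $\{1,\dots,n\}\setminus Z$ whose blocks $B$ are enriched by functions $f:B\to G$ taken up to right multiplication by a constant in $G$. The order is generated by the covers: (i) a block is removed from $\tilde\pi$ and added to $Z$; (ii) two enriched blocks $(B,f),(C,g)$ are replaced by $(B\cup C,h)$ with $h=f$ on $B$ and $h=\alpha\cdot g$ on $C$ for some $\alpha\in G$. $L_n$ is graded of rank $n$. Partition lattice $\Pi_n$: set partitions of $\{1,\dots,n\}$ ordered by refinement. Exponential structure: a sequence $\mathbf Q=(Q_1,Q_2,\dots)$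 of finite posets such that (E1) $Q_n$ has a unique maximal element $\hat1$ and every maximal chain of $Q_n$ has $n$ elements; (E2) for $x\in Q_n$ of rank $k$, $[x,\hat1]\cong\Pi_{n-k}$; (E3) the lower order ideal generated by $x\in Q_n$ is isomorphic to $Q_1^{a_1}\times\cdots\times Q_n^{a_n}$ for some nonnegative integers $(a_1,\dots,a_n)$, the type of $x$; (E4) $M(n)$ is the number of minimal elements of $Q_n$. Exponential Dowling structure associated to $\mathbf Q$: a sequence $\mathbf R=(R_0,R_1,\dots)$ of finite posets such that (D1) $R_n$ has a unique maximal element $\hat1$ and every maximal chain of $R_n$ has $n+1$ elements (rank function $\rho$); (D2) for $x\in R_n$, $[x,\hat1]\cong L_{n-\rho(x)}$; (D3) each $x\in R_n$ is assigned a type $(b;a_1,\dots,a_n)$ of nonnegative integers such that the lower order ideal generated by $x$ is isomorphic to $R_b\times Q_1^{a_1}\times\cdots\times Q_n^{a_n}$; (D4) $N(n)$ is the number of minimal elements of $R_n$. Restrictions: $Q_n^I$ is the subposet of $Q_n$ of elements of type $(a_1,\dots,a_n)$ with ($a_i>0\Rightarrow i\in I$); for every positive integer $n$, $m_n=1+\sum_{x\in Q_n^I}\mu(\hat0,x)$, computed in $Q_n^I\cup\{\hat0\}$ ($\hat0$ a new minimum). $R_n^{I,J}$ is the subposet of $R_n$ of elements of type $(b;a_1,\dots,a_n)$ with $b\in J$ and ($a_i>0\Rightarrow i\in I$). For $n\in J$, $\mu_{I,J}(n)$ is the Möbius function $\mu(\hat0,\hat1)$ of $R_n^{I,J}\cup\{\hat0\}$;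 for $n\notin J$, $\mu_{I,J}(n)=0$. For every $n\ge0$, $p_n=1+\sum_{x\in R_n^{I,J}}\mu(\hat0,x)$, computed in $R_n^{I,J}\cup\{\hat0\}$.
   Formalization: Types in Q_n must satisfy Σ i·a_i = n; above each minimal element of R_n, some isomorphism with L_n must carry types to Dowling-lattice types (arbitrary types make the claim false); the Dowling merge uses g·α, on the same side as the equivalence, instead of α·g. *)

(* Defs.v *)
From HB Require Import structures.
From mathcomp Require Import all_boot all_order all_algebra all_fingroup.

Set Implicit Arguments.
Unset Strict Implicit.
Unset Printing Implicit Defensive.

Import Order.TTheory GRing.Theory Num.Theory.

Local Open Scope ring_scope.

(** * Finite posets *)

Definition order_iso (S T : Type) (leS : rel S) (leT : rel T) : Prop :=
  exists2 f : S -> T, bijective f & {mono f : x y / leS x y >-> leT x y}.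

Section FinitePosets.
Variables (d : Order.disp_t) (T : finPOrderType d).
Implicit Types (x y z : T) (C : {set T}).

Definition is_maximal x := [forall y, (x <= y)%O ==> (y == x)].
Definition is_minimal x := [forall y, (y <= x)%O ==> (y == x)].
Definition nb_minimal : nat := #|[set x : T | is_minimal x]|.

Definition is_chain C := [forall x in C, forall y in C, (x >=< y)%O].
Definition is_maximal_chain C := maxset is_chain C.

(* The number of elements of a longest chain strictly below x; in a poset whose
   maximal chains all have the same cardinality this is the rank function. *)
Definition rank x : nat :=
  (\max_(C : {set T} | is_chain C && [forall y in C, (y < x)%O]) #|C|)%N.

Definition ideal x := {y : T | (y <= x)%O}.
Definition ideal_le x : rel (ideal x) := fun u v => (val u <= val v)%O.

Definition poset_interval x z := {y : T | (x <= y <= z)%O}.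
Definition poset_interval_le x z : rel (poset_interval x z) :=
  fun u v => (val u <= val v)%O.

End FinitePosets.

(** * Moebius functions *)

Section Moebius.
Variables (T : finType) (le : rel T) (A : {pred T}).

(* The Moebius function of the subposet A of (T, le), by recursion on the upper
   end point. The argument k bounds the depth of the recursion, which descends
   a strict chain of T, so that #|T| is always enough. *)
Fixpoint moebius_rec (k : nat) (x y : T) : int :=
  if x == y then 1 else
  if k is k'.+1 then
    if le x y then
      - \sum_(z in A | [&& le x z, le z y & z != y]) moebius_rec k' x z
    else 0
  else 0.

Definition moebius : T -> T -> int := moebius_rec #|T|.

End Moebius.

(* None is the new minimum. *)
Definition bot_le (T : Type) (le : rel T) : rel (option T) := fun u v =>
  match u, v with
  | None, _ => true
  | Some _, None => false
  | Some x, Some y => le x y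
  end.

Section AdjoinMinimum.
Variables (d : Order.disp_t) (T : finPOrderType d) (A : {set T}).

(* A together with a new minimum, as a subposet of option T. *)
Definition with_bot : {pred option T} :=
  [pred u | if u is Some x then x \in A else true].

Definition mu_bot (x : T) : int :=
  moebius (bot_le <=%O) with_bot None (Some x).

Definition one_plus_mu_sum : int := 1 + \sum_(x in A) mu_bot x.

End AdjoinMinimum.

(** * Partition lattices *)

Definition set_partition (n : nat) :=
  {P : {set {set 'I_n}} | partition P [set: 'I_n]}.

Definition refines (n : nat) : rel (set_partition n) := fun P P' =>
  [forall B in val P, exists C in val P', B \subset C].

(** * Dowling lattices *)

Section Dowling.
Variables (gT : finGroupType) (n : nat).

(* A function from a subset B of the ground set to gT, extended by None. *)
Definition pfun := {ffun 'I_n -> option gT}.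
Implicit Types (f g : pfun) (c : gT) (E : {set pfun}).

Definition pdom f : {set 'I_n} := [set i | f i].

Definition pmulr f c : pfun := [ffun i => omap (fun h => (h * c)%g) (f i)].

(* f on its domain, and g elsewhere. *)
Definition pjoin f g : pfun := [ffun i => if f i is Some h then Some h else g i].

(* The enriched block represented by f: the class of f under right
   multiplication by constants. *)
Definition enriched_block f : {set pfun} := [set pmulr f c | c : gT].

Definition underlying E : {set 'I_n} := \bigcup_(f in E) pdom f.

Definition is_dowling_elt (w : {set {set pfun}} * {set 'I_n}) : bool :=
  [&& [forall E in w.1, exists f, E == enriched_block f],
      [forall E in w.1, forall F in w.1,
         (underlying E == underlying F) ==> (E == F)]
    & partition [set underlying E | E in w.1] (~: w.2)].

Definition dowling := {w | is_dowling_elt w}.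

Definition blocks (w : dowling) : {set {set pfun}} := (val w).1.
Definition zero_block (w : dowling) : {set 'I_n} := (val w).2.

Definition absorb_block (u v : dowling) : bool :=
  [exists E in blocks u,
     (blocks v == blocks u :\ E)
     && (zero_block v == zero_block u :|: underlying E)].

(* The constant acts on the same side as in enriched_block: this is what makes
   the set of the merged blocks independent of the representatives f and g. *)
Definition merge_blocks (u v : dowling) : bool :=
  (zero_block v == zero_block u) &&
  [exists f, exists g, exists c,
     [&& enriched_block f \in blocks u, enriched_block g \in blocks u,
         enriched_block f != enriched_block g
       & blocks v == enriched_block (pjoin f (pmulr g c))
                     |: (blocks u :\ enriched_block f :\ enriched_block g)]].

Definition dowling_le : rel dowling :=
  connect [rel u v | absorb_block u v || merge_blocks u v].

(* (b; a_1, ..., a_n), with a_i stored at index i - 1. *)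
Definition dowling_type (w : dowling) : nat * {ffun 'I_n -> nat} :=
  (#|zero_block w|,
   [ffun i : 'I_n => #|[set E in blocks w | #|underlying E| == i.+1]|]).

End Dowling.

(** * Exponential structures *)

(* The product of the Q_(i+1)^(a i) for i < n, ordered componentwise. *)
Definition power_prod (d : Order.disp_t) (Q : nat -> finPOrderType d)
    (n : nat) (a : {ffun 'I_n -> nat}) :=
  {dffun forall p : {i : 'I_n & 'I_(a i)}, Q (tag p).+1}.

Definition power_prod_le (d : Order.disp_t) (Q : nat -> finPOrderType d)
    (n : nat) (a : {ffun 'I_n -> nat}) : rel (power_prod Q a) :=
  fun u v => [forall p, (u p <= v p)%O].

(* The posets are indexed from 1: nothing is assumed on the posets of index 0.
   The type (a_1, ..., a_n) is stored with a_i at index i - 1. As Q_1 is a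
   point, the isomorphism in expQ_ideal says nothing on a_1, which is
   determined by expQ_type_weight. *)
Record exp_structure (d : Order.disp_t) := ExpStructure {
  expQ :> nat -> finPOrderType d;
  expQ_top : forall n, expQ n;
  expQ_type : forall n, expQ n -> {ffun 'I_n -> nat};
  expQ_topP : forall n, (0 < n)%N ->
    forall x : expQ n, is_maximal x <-> x = expQ_top n;
  expQ_chain : forall n, (0 < n)%N ->
    forall C : {set expQ n}, is_maximal_chain C -> #|C| = n;
  expQ_upper : forall n, (0 < n)%N ->
    forall x : expQ n,
      order_iso (@poset_interval_le _ _ x (expQ_top n)) (@refines (n - rank x));
  expQ_ideal : forall n, (0 < n)%N ->
    forall x : expQ n,
      order_iso (@ideal_le _ _ x) (@power_prod_le _ expQ n (expQ_type x));
  expQ_type_weight : forall n, (0 < n)%N ->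
    forall x : expQ n, (\sum_(i < n) i.+1 * expQ_type x i)%N = n
}.

(* M(n), with M(0) = 1. *)
Definition expQ_M (d : Order.disp_t) (Q : exp_structure d) (n : nat) : nat :=
  if n is 0 then 1%N else nb_minimal (Q n).

(** * Exponential Dowling structures *)

(* expR_type_compat: above a minimal element, the types are those of the
   Dowling lattice. The isomorphisms in expR_ideal alone do not pin them down:
   Q_1 is a point, the posets L_1 and Pi_2 are both chains with two elements,
   and L_b is isomorphic to Pi_(b+1) when the group is trivial. *)
Record exp_dowling_structure (gT : finGroupType) (d d' : Order.disp_t)
    (Q : exp_structure d) := ExpDowlingStructure {
  expR :> nat -> finPOrderType d';
  expR_top : forall n, expR n;
  expR_type : forall n, expR n -> nat * {ffun 'I_n -> nat};
  expR_topP : forall n (x : expR n), is_maximal x <-> x = expR_top n;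
  expR_chain : forall n (C : {set expR n}), is_maximal_chain C -> #|C| = n.+1;
  expR_upper : forall n (x : expR n),
    order_iso (@poset_interval_le _ _ x (expR_top n)) (@dowling_le gT (n - rank x));
  expR_ideal : forall n (x : expR n),
    order_iso (@ideal_le _ _ x)
      (fun u v : expR (expR_type x).1 * power_prod Q (expR_type x).2 =>
         (u.1 <= v.1)%O && power_prod_le u.2 v.2);
  expR_type_compat : forall n (x : expR n), is_minimal x ->
    exists f : poset_interval x (expR_top n) -> dowling gT n,
      [/\ bijective f,
          {mono f : y z / poset_interval_le y z >-> dowling_le y z}
        & forall y, dowling_type (f y) = expR_type (val y)]
}.

Definition expR_N (gT : finGroupType) (d d' : Order.disp_t)
    (Q : exp_structure d) (R : exp_dowling_structure gT d' Q) (n : nat) : nat :=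
  nb_minimal (R n).

(** * Restricted structures *)

Section Restriction.
Variables (gT : finGroupType) (d d' : Order.disp_t) (Q : exp_structure d).
Variables (R : exp_dowling_structure gT d' Q) (I J : {pred nat}).

Definition parts_in (n : nat) (a : {ffun 'I_n -> nat}) : bool :=
  [forall i : 'I_n, (0 < a i)%N ==> (i.+1 \in I)].

Definition restrQ (n : nat) : {set Q n} :=
  [set x : Q n | parts_in (expQ_type x)].

Definition restrR (n : nat) : {set R n} :=
  [set x : R n | ((expR_type x).1 \in J) && parts_in (expR_type x).2].

Definition m_restr (n : nat) : int := one_plus_mu_sum (restrQ n).

Definition p_restr (n : nat) : int := one_plus_mu_sum (restrR n).

Definition mu_restr (n : nat) : int :=
  if n \in J then mu_bot (restrR n) (expR_top R n) else 0.

End Restriction.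

(** * Formal power series over rat, as sequences of coefficients *)

Definition fps := nat -> rat.

Definition fps_one : fps := fun n => (n == 0%N)%:R.

Definition fps_sub (A B : fps) : fps := fun n => A n - B n.

Definition fps_mul (A B : fps) : fps :=
  fun n => \sum_(i < n.+1) A i * B (n - i)%N.

Definition fps_exp (A : fps) (k : nat) : fps := iter k (fps_mul A) fps_one.

(* B_0 = 1 / A_0 and B_n = - (1 / A_0) * \sum_(i < n) A_(n - i) B_i, which is
   the inverse of A when A_0 != 0. *)
Fixpoint fps_inv_rec (A : fps) (k n : nat) : rat :=
  if k is k'.+1 then
    (fps_one n - \sum_(i < n) A (n - i)%N * fps_inv_rec A k' i) / A 0%N
  else 0.

Definition fps_inv (A : fps) : fps := fun n => fps_inv_rec A n.+1 n.

Definition fps_div (A B : fps) : fps := fps_mul A (fps_inv B).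

Definition binomial_rat (r : rat) (k : nat) : rat :=
  (\prod_(i < k) (r - i%:R)) / k`!%:R.

(* For A_0 = 1, the power A^r = \sum_(k >= 0) binom(r, k) (A - 1)^k; as A - 1
   has no constant term, only the k <= n contribute to the coefficient of x^n. *)
Definition fps_pow (A : fps) (r : rat) : fps := fun n =>
  \sum_(k < n.+1) binomial_rat r k * fps_exp (fps_sub A fps_one) k n.

(* Main.v *)
Require Import Defs.
From HB Require Import structures.
From mathcomp Require Import all_boot all_order all_algebra all_fingroup.
From mathcomp Require Import ring.

Set Implicit Arguments.
Unset Strict Implicit.
Unset Printing Implicit Defensive.

Import Order.TTheory GRing.Theory Num.Theory.

Local Open Scope ring_scope.

(** Every element of [Q_n] or [R_n] lies above a minimal element [m], and
    [[m, 1]] is a partition or a Dowling lattice. Hence a sum over the [y <= x]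
    of a function of the type can be computed in these lattices, after division
    by the number of minimal elements below [y]; multiplicative functions of
    the type then have multiplicative sums. As the Moebius function
    [mu(0, x)] of the restricted poset is characterized by its sums over the
    down-sets, it is, up to sign, the multiplicative function
    [G(b) prod_i h(i)^(a_i)] with [h(i)] and [G(b)] its values at the tops, and
    the sums at the tops, collected in exponential generating functions, give
    [C(x) = exp(B(x))] for [Q], where [B] has coefficients [h(i) / M(i)], and
    [A(x) exp(B(s x) / s)] for [R], where [A] has coefficients [G(b) / N(b)].
    For [Q] the types must first be matched with those of partitions: the
    number of blocks of each size is read off the interval [[m, x]] as a number
    of maximal directly indecomposable elements. *)

(** * Moebius functions with an adjoined minimum *)

(** The weights are minus the Moebius values, so their sums over the down-sets of kept elements are
    1 and their totals over the whole posets are [1 - m_n] and [1 - p_n]. For an index kept by the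
    restriction [m_n] or [p_n] vanishes, so that both cases of a coefficient in the statement are
    one formula. Building the weights from the values at the tops is not circular: below the top of
    [Q_n] only smaller indices occur, and below the top of [R_n] only smaller zero blocks, [Q] being
    settled before.

    The power [1/s] comes from the blocks that the zero block swallows. A set [Y] inside it carries
    [s^(|Y|-1)] enrichments, while a subset of an enriched block inherits exactly one. The former
    sum to [exp(B(s x)/s)], the [s]-th root of [C(s x)]. The power being a binomial series, this
    root is recognized by its linear differential equation.

    The obstacle for [Q] is that the isomorphisms of lower ideals and of upper intervals are
    unrelated a priori: nothing says that the exponents of the product count blocks. Bell numbers
    link the two, since a set of [k] elements has [bell k] partitions and [bell] is injective on
    positive integers. *)

Section MoebiusBottom.
Variables (d : Order.disp_t) (T : finPOrderType d) (A : {set T}).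

Lemma moebius_rec_refl (k : nat) (u : option T) :
  moebius_rec (bot_le <=%O) (with_bot A) k u u = 1.
Proof. by case: k => [|k] /=; rewrite eqxx. Qed.

Lemma moebius_recS (k : nat) (x : T) :
  moebius_rec (bot_le <=%O) (with_bot A) k.+1 None (Some x) =
  - (1 + \sum_(z in A | (z < x)%O)
           moebius_rec (bot_le <=%O) (with_bot A) k None (Some z)).
Proof.
rewrite /=; congr (- _).
rewrite (bigD1 None) //= moebius_rec_refl; congr (_ + _).
rewrite [LHS](reindex_omap (Some : T -> option T) id) /=;
  last by case=> [z|]; rewrite ?eqxx ?andbF // => /andP[].
apply: eq_bigl => z; rewrite eqxx andbT lt_neqAle.
by rewrite andbT; congr (_ && _); rewrite andbC.
Qed.

(** Each recursive call moves to a strictly smaller element, so any fuel above the number of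
    elements strictly below [x] is enough. *)
Lemma moebius_rec_fuel (k k' : nat) (x : T) :
  (#|[set z : T | (z < x)%O]| < k)%N -> (#|[set z : T | (z < x)%O]| < k')%N ->
  moebius_rec (bot_le <=%O) (with_bot A) k None (Some x) =
  moebius_rec (bot_le <=%O) (with_bot A) k' None (Some x).
Proof.
elim: k k' x => [//|k IHk] [//|k'] x ltk ltk'.
rewrite !moebius_recS; congr (- (1 + _)); apply: eq_bigr => z /andP[_ ltzx].
have ltcard : (#|[set y : T | (y < z)%O]| < #|[set y : T | (y < x)%O]|)%N.
  apply/proper_card/properP; split.
    by apply/subsetP => y; rewrite !inE => /lt_trans; apply.
  by exists z; rewrite inE ?ltxx.
by apply: IHk; apply: leq_trans ltcard _.
Qed.

Lemma mu_botE (x : T) :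
  mu_bot A x = - (1 + \sum_(z in A | (z < x)%O) mu_bot A z).
Proof.
have lt_card y : (#|[set z : T | (z < y)%O]| < #|T|)%N.
  rewrite -cardsT; apply/proper_card/properP; split; first exact: subsetT.
  by exists y; rewrite inE ?ltxx.
rewrite /mu_bot /moebius card_option moebius_recS; congr (- (1 + _)).
by apply: eq_bigr => z _; apply: moebius_rec_fuel; rewrite ?ltnS // ltnW.
Qed.

(** By [mu_botE], minus the Moebius function is the only function with down-set sums 1. The top is
    exempt from the sum condition and has a prescribed value instead: the weights are defined there
    by [mu_bot], and the sum at the top is a consequence to be drawn later. *)
Lemma mu_bot_unique (w : T -> rat) (top : T) :
  (forall x, (x <= top)%O) ->
  (forall x, x \in A -> x != top -> \sum_(y in A | (y <= x)%O) w y = 1) ->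
  (top \in A -> w top = - (mu_bot A top)%:~R) ->
  forall x, x \in A -> w x = - (mu_bot A x)%:~R.
Proof.
move=> le_top sum_w w_top x.
have [k] := ubnP #|[set z : T | (z < x)%O]|.
elim: k x => // k IHk x; rewrite ltnS => lek xA.
have [xtop|xNtop] := eqVneq x top; first by rewrite xtop in xA *; apply: w_top.
rewrite mu_botE rmorphN opprK rmorphD rmorph_sum /=.
have := sum_w x xA xNtop; rewrite (bigD1 x) /=; last by rewrite xA lexx.
move=> /(canRL (addrK _)) ->; congr (1 + _); rewrite -sumrN.
apply: eq_big => [y|y /andP[/andP[yA leyx] yNx]].
  by rewrite lt_neqAle -!andbA [(y != x) && _]andbC.
rewrite IHk ?opprK //; apply: leq_trans _ lek.
have ltyx : (y < x)%O by rewrite lt_neqAle yNx.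
apply/proper_card/properP; split.
  by apply/subsetP => z; rewrite !inE => /lt_trans; apply.
by exists y; rewrite inE ?ltxx.
Qed.

Lemma one_plus_mu_sumE (w : T -> rat) :
  (forall x, x \in A -> w x = - (mu_bot A x)%:~R) ->
  (forall x, x \notin A -> w x = 0) ->
  \sum_x w x = 1 - (one_plus_mu_sum A)%:~R.
Proof.
move=> wA wNA; rewrite /one_plus_mu_sum rmorphD rmorph_sum opprD addNKr -sumrN.
rewrite [RHS]big_mkcond /=; apply: eq_bigr => x _.
by case: ifP => [/wA|/negbT/wNA].
Qed.

(** The recursion at the top makes its value cancel 1 and all the other values. This is why the
    corrections [m_n] and [p_n] only occur in the theorem outside [I] and [J]. *)
Lemma one_plus_mu_sum0 (top : T) :
  (forall x, (x <= top)%O) -> top \in A -> one_plus_mu_sum A = 0.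
Proof.
move=> le_top topA; rewrite /one_plus_mu_sum (bigD1 top) //= mu_botE opprD -!addrA addNKr.
apply/eqP; rewrite addrC subr_eq0; apply/eqP/eq_bigl => x.
by rewrite lt_neqAle le_top andbT.
Qed.
End MoebiusBottom.

(** * Formal power series *)

Section PowerSeries.
Implicit Types (A B C : fps).

Lemma fps_inv_recE A k n : (n < k)%N -> fps_inv_rec A k n = fps_inv A n.
Proof.
rewrite /fps_inv; elim/ltn_ind: n k => n IHn [//|k] ltnk /=.
congr ((_ - _) / _); apply: eq_bigr => i _; congr (_ * _).
by rewrite [RHS]IHn // IHn // (leq_trans (ltn_ord i)).
Qed.

Lemma fps_mulC A B : fps_mul A B =1 fps_mul B A.
Proof.
move=> n; rewrite /fps_mul (reindex_inj rev_ord_inj) /=; apply: eq_bigr => i _.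
by rewrite subSS mulrC subKn // -ltnS.
Qed.

(** A coefficient of a product depends on truncations only, so ring laws and derivatives can be
    borrowed from [{poly rat}]. *)
Lemma fps_mul_poly A B n k : (k < n)%N ->
  fps_mul A B k = (\poly_(i < n) A i * \poly_(i < n) B i)`_k.
Proof.
move=> ltkn; rewrite coefM; apply: eq_bigr => i _; rewrite !coef_poly.
by rewrite (leq_ltn_trans _ ltkn) ?(leq_ltn_trans _ ltkn) ?leq_subr // -ltnS.
Qed.

Lemma eq_fps_mul n A A' B B' :
  (forall k, (k <= n)%N -> A k = A' k) -> (forall k, (k <= n)%N -> B k = B' k) ->
  fps_mul A B n = fps_mul A' B' n.
Proof.
move=> eqA eqB; apply: eq_bigr => i _.
by rewrite eqA ?eqB ?leq_subr // -ltnS.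
Qed.

Lemma fps_mulA A B C : fps_mul A (fps_mul B C) =1 fps_mul (fps_mul A B) C.
Proof.
move=> n; have Pmul := @fps_mul_poly _ _ n.+1 n (ltnSn n).
rewrite !Pmul.
have E D D' : \poly_(i < n.+1) fps_mul D D' i =
   take_poly n.+1 (\poly_(i < n.+1) D i * \poly_(i < n.+1) D' i).
  by apply/polyP => i; rewrite coef_take_poly coef_poly; case: ifP => // /fps_mul_poly ->.
rewrite !E.
have take_mul p q : (p * take_poly n.+1 q)`_n = (p * q)`_n.
  rewrite !coefM; apply: eq_bigr => i _.
  by rewrite coef_take_poly ltnS leq_subr.
by rewrite take_mul [take_poly _ _ * _]mulrC take_mul mulrA [in RHS]mulrC.
Qed.

Lemma fps_mulV A : A 0%N != 0 -> fps_mul A (fps_inv A) =1 fps_one.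
Proof.
move=> A0 n; rewrite fps_mulC /fps_mul big_ord_recr /= subnn.
rewrite {2}/fps_inv /= mulfVK //.
under [X in _ - X]eq_bigr => i _ do rewrite fps_inv_recE // mulrC.
by rewrite addrC subrK.
Qed.

Lemma fps_mul1 A : fps_mul A fps_one =1 A.
Proof.
move=> n; rewrite fps_mulC /fps_mul big_ord_recl /= mul1r subn0.
by rewrite big1 ?addr0 // => i _; rewrite mul0r.
Qed.

Lemma fps_div_eq A B C : B 0%N != 0 -> C =1 fps_mul A B -> A =1 fps_div C B.
Proof.
move=> B0 eqC n; rewrite /fps_div (@eq_fps_mul n _ (fps_mul A B) _ (fps_inv B)) //.
rewrite -fps_mulA -[LHS]fps_mul1; apply: eq_fps_mul => // k _.
by rewrite fps_mulV.
Qed.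

End PowerSeries.

(** This is the coefficient of [u^k] in [(1 + u) F' = r F], where [F] is the binomial series of
    [(1 + u)^r]. *)
Lemma binomial_ratS r k :
  k.+1%:R * binomial_rat r k.+1 + k%:R * binomial_rat r k = r * binomial_rat r k.
Proof.
rewrite /binomial_rat big_ord_recr /= factS natrM.
set P := \prod_(_ < k) _.
have f0 : k`!%:R != 0 :> rat by rewrite pnatr_eq0 -lt0n fact_gt0.
have k0 : k.+1%:R != 0 :> rat by rewrite pnatr_eq0.
by rewrite -natr1 in k0 *; field; rewrite f0.
Qed.

Lemma fps_exp_poly A k n m : (n < m)%N ->
  fps_exp A k n = ((\poly_(i < m) A i) ^+ k)`_n.
Proof.
elim: k n => [|k IHk] n ltnm; first by rewrite expr0 coef1.
rewrite exprS coefM; apply: eq_bigr => i _.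
rewrite coef_poly (@leq_ltn_trans n) //; last by rewrite -ltnS.
by rewrite -IHk // (leq_ltn_trans _ ltnm) // leq_subr.
Qed.

(** Vanishing of the low coefficients is phrased as divisibility so that factors prime to ['X] can
    be cancelled. *)
Lemma dvd_XnP (p : {poly rat}) n :
  reflect (forall k, (k < n)%N -> p`_k = 0) ('X^n %| p).
Proof.
apply: (iffP idP) => [/dvdpP[q ->] k ltkn|p0]; first by rewrite coefMXn ltkn.
apply/dvdpP; exists (drop_poly n p); rewrite -[LHS](poly_take_drop n).
rewrite addrC -[RHS]addr0; congr (_ + _); apply/polyP => i.
by rewrite coef_take_poly coef0; case: ifP => // /p0.
Qed.

(** * Powers of a series through a linear differential equation *)

Section FpsPower.
Variables (C D E : fps) (r : rat) (s : rat).
Hypotheses (C0 : C 0%N = 1) (D0 : D 0%N = 1) (rs : r * s = 1).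
Hypothesis C_ode : forall n, n.+1%:R * C n.+1 = s * fps_mul E C n.
Hypothesis D_ode : forall n, n.+1%:R * D n.+1 = fps_mul E D n.

(* With [U = C - 1], the truncation [P] of the binomial series of [C^r]
   satisfies [C P' = r C' P] up to a multiple of [U^(n+1)]. *)
Lemma binomial_series_ode (n : nat) (U P : {poly rat}) :
  P = \sum_(k < n.+2) binomial_rat r k *: U ^+ k ->
  U ^+ n.+1 %| (1 + U) * P^`() - r *: (U^`() * P).
Proof.
move=> defP; set b := binomial_rat r in defP *.
have Pder : P^`() = U^`() * \sum_(k < n.+1) (k.+1%:R * b k.+1) *: U ^+ k.
  rewrite defP raddf_sum big_ord_recl /= expr0 alg_polyC derivC add0r mulr_sumr.
  apply: eq_bigr => k _; rewrite derivZ deriv_exp /= -mulr_natl.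
  by rewrite -scalerAr -polyC_natr mul_polyC scalerA [_ * b _]mulrC.
suff -> : (1 + U) * P^`() - r *: (U^`() * P) =
          - (n.+2%:R * b n.+2) *: (U^`() * U ^+ n.+1).
  by rewrite -mul_polyC !dvdp_mull.
rewrite Pder mulrCA !scalerAr -mulrBr; congr (_ * _).
(* Multiplication by [U] shifts the index and pairs consecutive coefficients as in [binomial_ratS];
   only the truncation term at [k = n+1] is left over. *)
have -> : (1 + U) * (\sum_(k < n.+1) (k.+1%:R * b k.+1) *: U ^+ k) =
  \sum_(k < n.+2) (k.+1%:R * b k.+1 + k%:R * b k) *: U ^+ k
  - (n.+2%:R * b n.+2) *: U ^+ n.+1.
  under [in RHS]eq_bigr => k _ do rewrite scalerDl.
  rewrite big_split /= [X in X + _ - _]big_ord_recr [X in _ + X - _]big_ord_recl /=.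
  rewrite mul0r scale0r add0r addrAC addrK mulrDl mul1r mulr_sumr.
  by congr (_ + _); apply: eq_bigr => k _; rewrite -scalerAr exprS.
under eq_bigr => k _ do rewrite binomial_ratS -scalerA.
by rewrite -scaler_sumr -defP addrAC subrr add0r scaleNr.
Qed.

(** The logarithmic derivative of [C^r] is [r] times that of [C], that is [r s E = E]. Truncation
    keeps degrees up to [n+1], as the derivative loses one. *)
Lemma fps_pow_ode n : n.+1%:R * fps_pow C r n.+1 = fps_mul E (fps_pow C r) n.
Proof.
pose U := \poly_(i < n.+2) fps_sub C fps_one i.
pose P := \sum_(k < n.+2) binomial_rat r k *: U ^+ k.
have U0 : U`_0 = 0 by rewrite coef_poly /fps_sub C0 subrr.
have dvdXU : 'X %| U by rewrite -['X]subr0 dvdp_XsubCl rootE horner_coef0 U0.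
have coefU i : (i <= n.+1)%N -> (1 + U)`_i = C i.
  by move=> lein; rewrite coefD coef1 coef_poly ltnS lein /fps_sub addrC subrK.
have coefP i : (i <= n.+1)%N -> P`_i = fps_pow C r i.
  move=> lein; rewrite coef_sum /fps_pow.
  rewrite (big_ord_widen_cond n.+2 predT (fun k => binomial_rat r k * fps_exp (fps_sub C fps_one) k i)) //=.
  rewrite [RHS]big_mkcond /=; apply: eq_bigr => k _.
  rewrite coefZ -/U (@fps_exp_poly _ _ _ n.+2) // -/U.
  (* [P] has more terms than [fps_pow C r i]; the additional ones have [k > i] and vanish in degree
     [i], because ['X] divides [U]. *)
  case: ifP => // /negbT; rewrite -leqNgt => ltik.
  by have := dvdp_exp2r k dvdXU => /dvd_XnP -> //; rewrite mulr0.
have ode_P := dvdp_trans (dvdp_exp2r n.+1 dvdXU) (@binomial_series_ode n U P erefl).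
pose e := \poly_(i < n.+2) E i.
have coefeM (q : {poly rat}) A : (forall i, (i <= n)%N -> q`_i = A i) ->
    forall k, (k <= n)%N -> (e * q)`_k = fps_mul E A k.
  move=> qA k lekn; rewrite coefM; apply: eq_bigr => i _.
  have lein : (i <= n)%N by rewrite (leq_trans _ lekn) // -ltnS.
  by rewrite coef_poly ltnS leqW // qA // (leq_trans (leq_subr _ _) lekn).
have ode_U : 'X^(n.+1) %| U^`() - s *: (e * (1 + U)).
  apply/dvd_XnP => k; rewrite ltnS => lekn; apply/eqP.
  rewrite coefB coefZ (@coefeM _ C) //; last by move=> i lein; rewrite coefU // leqW.
  have Uk : U`_k.+1 = C k.+1 by rewrite -coefU // coefD coef1 add0r.
  by rewrite -C_ode coef_deriv Uk mulr_natl subrr.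
have: 'X^(n.+1) %| (1 + U) * (P^`() - e * P).
  have -> : (1 + U) * (P^`() - e * P) = ((1 + U) * P^`() - r *: (U^`() * P))
     + r *: P * (U^`() - s *: (e * (1 + U))).
    have {1}-> : e = r%:P * s%:P * e by rewrite -polyCM rs mul1r.
    by rewrite -!mul_polyC; ring.
  by rewrite dvdp_add // dvdp_mull.
(* The factor [1 + U] has constant term 1, hence is prime to ['X] and can be cancelled. *)
rewrite Gauss_dvdpr; last first.
  rewrite coprimep_expl // coprimep_sym -['X]subr0 coprimep_XsubC rootE.
  by rewrite horner_coef0 coefU // C0 oner_eq0.
move/dvd_XnP/(_ n (ltnSn n)); rewrite coefB (@coefeM _ (fps_pow C r)) //; last first.
  by move=> i lein; rewrite coefP // leqW.
by move/eqP; rewrite subr_eq0 => /eqP <-; rewrite coef_deriv coefP // mulr_natl.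
Qed.

(** Both sides solve [F' = E F] with constant term 1, which determines the coefficients one after
    the other. *)
Lemma fps_pow_exp : fps_pow C r =1 D.
Proof.
move=> n; elim/ltn_ind: n => -[|n] IHn.
  by rewrite D0 /fps_pow big_ord_recl big_ord0 /binomial_rat big_ord0 /= divr1 mul1r addr0.
have n0 : n.+1%:R != 0 :> rat by rewrite pnatr_eq0.
apply: (mulfI n0); rewrite fps_pow_ode D_ode.
by apply: eq_fps_mul => // k lekn; rewrite IHn.
Qed.

End FpsPower.

(** * Sums over families of blocks *)

Section BlockSums.
Variables (T E : finType) (dom : E -> {set T}).
Implicit Types (X Y : {set T}) (W : {set E}).

(** Blocks are abstract elements with a domain, to cover both plain sets and enriched blocks. The
    injectivity clause excludes two blocks with the same domain, which the set of domains cannot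
    detect. *)
Definition block_partition X W : bool :=
  [forall e in W, forall f in W, (dom e == dom f) ==> (e == f)]
  && partition [set dom e | e in W] X.

Lemma block_partitionP X W :
  reflect [/\ cover [set dom e | e in W] = X,
              forall e, e \in W -> dom e != set0
            & forall e f, e \in W -> f \in W -> e != f -> [disjoint dom e & dom f]]
          (block_partition X W).
Proof.
apply: (iffP andP) => [[/forall_inP inj /and3P[/eqP cov /trivIsetP triv n0]]|[cov n0 triv]].
  have injW e f : e \in W -> f \in W -> dom e = dom f -> e = f.
    by move=> eW fW /eqP; have /forall_inP/(_ f fW)/implyP/[apply]/eqP := inj e eW.
  split=> // [e eW|e f eW fW neq].
    by apply: contraNneq n0 => <-; apply: imset_f.
  by apply: triv; rewrite ?imset_f //; apply: contraNneq neq => /injW ->.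
split.
  apply/forall_inP => e eW; apply/forall_inP => f fW; apply/implyP => /eqP eqd.
  apply: contraT => /(triv e f eW fW); rewrite eqd -setI_eq0 setIid => f0.
  by have := n0 f fW; rewrite f0.
apply/and3P; split; first by rewrite cov.
  apply/trivIsetP => _ _ /imsetP[e eW ->] /imsetP[f fW ->] neq.
  by apply: triv => //; apply: contraNneq neq => ->.
by apply/imsetP => -[e eW d0]; have := n0 e eW; rewrite -d0 eqxx.
Qed.

Lemma block_partition_cover X W : block_partition X W -> \bigcup_(e in W) dom e = X.
Proof. by case/block_partitionP => <- _ _; rewrite cover_imset. Qed.

Lemma block_partition0 W : block_partition set0 W = (W == set0).
Proof.
apply/idP/eqP => [bpW|->].
  apply/setP => e; rewrite inE; apply/negbTE/negP => eW.
  have /block_partitionP[_ /(_ e eW)/set0Pn[x xe] _] := bpW.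
  have := block_partition_cover bpW => /setP/(_ x); rewrite inE => /negP; apply.
  by apply/bigcupP; exists e.
apply/block_partitionP; split=> [|e|e f]; rewrite ?inE //.
by rewrite cover_imset big_set0.
Qed.

Lemma block_partitionD1 X e W : e \in W ->
  block_partition X W =
  [&& dom e != set0, dom e \subset X & block_partition (X :\: dom e) (W :\ e)].
Proof.
move=> eW; apply/idP/and3P => [bpW|[n0 sub bpW]].
  have [cov n0 triv] := block_partitionP _ _ bpW.
  have covX := block_partition_cover bpW.
  split; first exact: n0.
    by rewrite -covX (bigcup_max e).
  apply/block_partitionP; split=> [|f /setD1P[_] /n0//|f g /setD1P[_ fW] /setD1P[_ gW]].
    rewrite cover_imset -covX [in RHS](big_setD1 e) //= setDUl setDv set0U.
    apply/esym/setDidPl; rewrite disjoint_sym; apply/bigcup_disjointP => f /setD1P[neq fW].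
    by apply: triv; rewrite // eq_sym.
  exact: triv.
have [cov n0' triv] := block_partitionP _ _ bpW.
have covX := block_partition_cover bpW.
have disj f : f \in W -> f != e -> [disjoint dom e & dom f].
  move=> fW neq; rewrite disjoint_sym disjoints_subset; apply/subsetP => x xf.
  have: x \in X :\: dom e by rewrite -covX; apply/bigcupP; exists f; rewrite // !inE neq.
  by rewrite !inE => /andP[].
apply/block_partitionP; split=> [|f fW|f g fW gW neq].
- by rewrite cover_imset (big_setD1 e) //= covX setDE setUIr setUCr setIT (setUidPr sub).
- by have [->//|neq] := eqVneq f e; apply: n0'; rewrite !inE neq.
have [eqe|nfe] := eqVneq f e.
  by rewrite eqe in neq *; apply: disj; rewrite // eq_sym.
have [->|nge] := eqVneq g e; first by rewrite disjoint_sym; apply: disj.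
by apply: triv; rewrite ?inE ?nfe ?nge.
Qed.

Variables (R : comNzRingType) (c : E -> R).

Definition block_sum X : R := \sum_(W | block_partition X W) \prod_(e in W) c e.

Lemma block_sum0 : block_sum set0 = 1.
Proof.
rewrite /block_sum (eq_bigl (pred1 set0)) ?big_pred1_eq ?big_set0 // => W.
exact: block_partition0.
Qed.

(* The sum is split according to the block that contains [x]. *)
Lemma block_sum_rec X x : x \in X ->
  block_sum X =
  \sum_(e | (x \in dom e) && (dom e \subset X)) c e * block_sum (X :\: dom e).
Proof.
move=> xX; rewrite /block_sum.
have pick_block W : block_partition X W -> exists2 e, e \in W & x \in dom e.
  by move/block_partition_cover => cov; rewrite -cov in xX; have /bigcupP := xX.
pose h W := [pick e in W | x \in dom e].
(* The inner sum has a single term, given by the block of [W] that contains [x]; it is inserted so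
   that the two sums can be exchanged. *)
transitivity (\sum_(W | block_partition X W)
   \sum_(e | (e \in W) && (x \in dom e)) \prod_(f in W) c f).
  apply: eq_bigr => W bpW; have [e eW xe] := pick_block W bpW.
  rewrite [RHS](big_pred1 e) // => f; apply/andP/eqP => [[fW xf]|->//].
  have [_ _ triv] := block_partitionP _ _ bpW.
  apply/eqP; apply: contraT => /(triv f e fW eW)/pred0P/(_ x) /=.
  by rewrite xf xe.
rewrite (exchange_big_dep (fun e => (x \in dom e) && (dom e \subset X))) /=; last first.
  move=> W e bpW /andP[eW ->] /=.
  by move: bpW; rewrite (block_partitionD1 _ eW) => /and3P[].
apply: eq_bigr => e /andP[xe sub]; rewrite big_distrr /=.
have n0 : dom e != set0 by apply/set0Pn; exists x.
rewrite (reindex_onto (fun W => e |: W) (fun W => W :\ e)) /=; last first.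
  by move=> W /and3P[_ eW _]; rewrite setD1K.
apply: eq_big => [W|W /andP[_ /eqP/setP/(_ e)]]; last first.
  by rewrite setD11 => /esym/negbT eW; rewrite big_setU1.
rewrite setU11 xe !andbT; apply/andP/idP => [[bpW /eqP defW]|bpW].
  by move: bpW; rewrite (block_partitionD1 _ (setU11 e W)) defW => /and3P[].
have eW : e \notin W.
  apply/negP => eW; have := block_partition_cover bpW => /setP/(_ x).
  by rewrite !inE xe /= => /negbT/bigcupP; apply; exists e.
by rewrite (block_partitionD1 _ (setU11 e W)) setU1K // n0 sub eqxx.
Qed.

End BlockSums.

Section SetBlockSums.
Variables (T : finType) (R : comNzRingType).
Implicit Types (c : {set T} -> R) (X Y : {set T}) (P : {set {set T}}).

Lemma block_partition_id X P : block_partition id X P = partition P X.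
Proof.
rewrite /block_partition imset_id andb_idl // => _.
by apply/forall_inP => Y _; apply/forall_inP => Z _; apply/implyP.
Qed.

(* An arbitrary family of blocks reduces to ordinary set partitions, the
   weight of a set being the total weight of the blocks with this domain. *)
Lemma block_sum_dom (E : finType) (dom : E -> {set T}) (c : E -> R) X :
  block_sum dom c X = block_sum id (fun Y => \sum_(e | dom e == Y) c e) X.
Proof.
have [k] := ubnP #|X|; elim: k X => // k IHk X; rewrite ltnS => leXk.
have [->|[x xX]] := set_0Vmem X; first by rewrite !block_sum0.
rewrite !(block_sum_rec _ _ xX).
rewrite (partition_big dom (fun Y => (x \in Y) && (Y \subset X))) //=.
apply: eq_bigr => Y /andP[xY sub]; rewrite big_distrl /=.
apply: eq_big => [e|e /andP[_ /eqP ->]].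
  by have [->|] := eqVneq (dom e) Y; rewrite ?andbF // xY sub.
congr (_ * _); apply: IHk; apply: leq_trans leXk.
rewrite ltnNge; apply/negP => le.
have /eqP/setP/(_ x) : X :\: Y == X by rewrite eqEcard subsetDl.
by rewrite !inE xY xX.
Qed.

Lemma card_setD_lt X Y x : x \in X -> x \in Y -> (#|X :\: Y| < #|X|)%N.
Proof.
move=> xX xY; apply/proper_card/properP; split; first exact: subsetDl.
by exists x; rewrite // inE xY.
Qed.

Lemma eq_block_sum c c' X :
  (forall Y, Y != set0 -> Y \subset X -> c Y = c' Y) ->
  block_sum id c X = block_sum id c' X.
Proof.
move=> eqc; apply: eq_bigr => P; rewrite block_partition_id => partP.
apply: eq_bigr => Y YP; apply: eqc; first exact: partition_neq0 partP YP.
exact: partitionS partP YP.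
Qed.

(** A partition with a block meeting both sides has weight 0, so only pairs of partitions of [X] and
    of [Y] remain. The induction removes the block of a point of [X]. *)
Lemma block_sumU c X Y : [disjoint X & Y] ->
  (forall Z : {set T}, ~~ [disjoint Z & X] -> ~~ [disjoint Z & Y] -> c Z = 0) ->
  block_sum id c (X :|: Y) = block_sum id c X * block_sum id c Y.
Proof.
have [k] := ubnP #|X|; elim: k X => // k IHk X; rewrite ltnS => leXk dXY c0.
have [->|[x xX]] := set_0Vmem X; first by rewrite set0U block_sum0 mul1r.
have xXY : x \in X :|: Y by rewrite inE xX.
rewrite (block_sum_rec _ _ xXY) (block_sum_rec _ _ xX) big_distrl /=.
rewrite (bigID (fun Z : {set T} => Z \subset X)) /= addrC big1 ?add0r; last first.
  move=> Z /andP[/andP[xZ /subsetP ZXY] /subsetPn[y yZ yX]]; rewrite c0 ?mul0r //.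
    by apply/pred0Pn; exists x; rewrite /= xZ.
  by apply/pred0Pn; exists y; have := ZXY y yZ; rewrite /= yZ inE (negPf yX).
apply: eq_big => [Z|Z /andP[/andP[xZ _] ZX]].
  have [ZX|] := boolP (Z \subset X); last by rewrite !andbF.
  by rewrite (subset_trans ZX (subsetUl X Y)) !andbT.
have dZY : [disjoint Z & Y] by apply: disjointWl dXY.
have -> : (X :|: Y) :\: Z = (X :\: Z) :|: Y.
  by rewrite setDUl; congr (_ :|: _); apply/setDidPl; rewrite disjoint_sym.
rewrite -mulrA IHk //.
- exact: leq_trans (card_setD_lt xX xZ) leXk.
- by apply: disjointWl dXY; apply: subsetDl.
move=> Z' nX; apply: c0; apply: contra nX; apply: disjointWr; exact: subsetDl.
Qed.

Lemma block_sum_partition c P X : partition P X ->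
  (forall Y Z Z' : {set T}, Z \in P -> Z' \in P -> ~~ [disjoint Y & Z] -> ~~ [disjoint Y & Z'] ->
     Z != Z' -> c Y = 0) ->
  block_sum id c X = \prod_(Z in P) block_sum id c Z.
Proof.
have [k] := ubnP #|P|; elim: k P X => // k IHk P X; rewrite ltnS => lePk partP c0.
have [P0|[Z ZP]] := set_0Vmem P.
  move: (cover_partition partP); rewrite P0 big_set0 /cover big_set0 => <-.
  by rewrite block_sum0.
have subZ := partitionS partP ZP.
have partD : partition (P :\ Z) (X :\: Z).
  by move: partP; rewrite -!block_partition_id (block_partitionD1 id X ZP) => /and3P[].
rewrite (big_setD1 Z) //= -[X in LHS](setID X Z) (setIidPr subZ).
rewrite block_sumU; last first.
- move=> Y nYZ /pred0Pn[y /= /andP[yY]]; rewrite -(cover_partition partD).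
  case/bigcupP => Z' /setD1P[neq Z'P] yZ'; apply: (c0 Y Z Z') => //; last by rewrite eq_sym.
  by apply/pred0Pn; exists y; rewrite /= yY.
- by rewrite -setI_eq0 setIDA setIC -setIDA setDv setI0.
congr (_ * _); apply: IHk partD _.
  by apply: leq_trans lePk; rewrite [X in (_ < X)%N](cardsD1 Z) ZP.
by move=> Y Z1 Z2 /setD1P[_ Z1P] /setD1P[_ Z2P]; apply: c0.
Qed.

(** The block of a distinguished element has [i] further elements, chosen among the other [n']; [k]
    is fuel. *)
Fixpoint partition_sum_rec (b : nat -> R) (k n : nat) : R :=
  if n is n'.+1 then
    if k is k'.+1 then
      \sum_(i < n) 'C(n', i)%:R * b i.+1 * partition_sum_rec b k' (n' - i)
    else 0
  else 1.

(* The sum of the products of the [b #|Y|], [Y] in [P], over the partitions [P]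
   of a set with [n] elements. *)
Definition partition_sum b n := partition_sum_rec b n n.

Lemma partition_sum0 b : partition_sum b 0 = 1.
Proof. by []. Qed.

Lemma partition_sumS b n :
  partition_sum b n.+1 =
  \sum_(i < n.+1) 'C(n, i)%:R * b i.+1 * partition_sum b (n - i).
Proof.
have fuel k m : (m <= k)%N -> partition_sum_rec b k m = partition_sum b m.
  rewrite /partition_sum; elim/ltn_ind: m k => -[|m] IHm [|k] //= lemk.
  apply: eq_bigr => i _; congr (_ * _).
  by rewrite IHm 1?[in RHS]IHm ?ltnS ?leq_subr // (leq_trans (leq_subr _ _)).
rewrite {1}/partition_sum /=; apply: eq_bigr => i _.
by rewrite fuel // leq_subr.
Qed.

Lemma sum_subset_card (X : {set T}) (x : T) (F : nat -> R) : x \in X ->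
  \sum_(Y : {set T} | (x \in Y) && (Y \subset X)) F #|Y| =
  \sum_(i < #|X|) 'C(#|X|.-1, i)%:R * F i.+1.
Proof.
move=> xX; have cardX : #|X| = #|X :\ x|.+1 by rewrite [LHS](cardsD1 x) xX.
rewrite (reindex_onto (fun Y => x |: Y) (fun Y => Y :\ x)) /=; last first.
  by move=> Y /andP[xY _]; rewrite setD1K.
rewrite (eq_bigl (fun Y : {set T} => Y \subset X :\ x)); last first.
  move=> Y; rewrite setU11 /= subUset sub1set xX /= subsetD1.
  by apply: andb_id2l => _; apply/eqP/idP => [<-|]; [rewrite setD11 | apply: setU1K].
rewrite (partition_big (fun Y : {set T} => inord #|Y| : 'I_#|X :\ x|.+1) predT) //=.
rewrite cardX /=; apply: eq_bigr => i _.
rewrite (eq_bigr (fun=> F i.+1)) => [|Y /andP[sub /eqP defi]].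
  rewrite sumr_const mulr_natl; congr (_ *+ _).
  rewrite -cards_draws; apply: eq_card => Y; rewrite !inE.
  apply: andb_id2l => sub; apply/eqP/eqP => [<-|->]; last by rewrite inord_val.
  by rewrite inordK // ltnS subset_leq_card.
rewrite cardsU1 -defi inordK ?ltnS ?subset_leq_card //.
by move: sub; rewrite subsetD1 => /andP[_ ->].
Qed.

Lemma block_sum_card (b : nat -> R) X :
  block_sum id (fun Y => b #|Y|) X = partition_sum b #|X|.
Proof.
have [k] := ubnP #|X|; elim: k X => // k IHk X; rewrite ltnS => leXk.
have [->|[x xX]] := set_0Vmem X; first by rewrite block_sum0 cards0.
rewrite (block_sum_rec _ _ xX).
rewrite (eq_bigr (fun Y : {set T} => b #|Y| * partition_sum b (#|X| - #|Y|))).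
  rewrite (sum_subset_card (fun i => b i * partition_sum b (#|X| - i)) xX).
  rewrite (cardsD1 x) xX /= partition_sumS.
  by apply: eq_bigr => i _; rewrite subSS mulrA.
move=> Y /andP[xY sub]; rewrite IHk; last exact: leq_trans (card_setD_lt xX xY) leXk.
by rewrite cardsD (setIidPr sub).
Qed.

Lemma sum_subset (X : {set T}) (F : nat -> R) :
  \sum_(Y : {set T} | Y \subset X) F #|Y| = \sum_(i < #|X|.+1) 'C(#|X|, i)%:R * F i.
Proof.
rewrite (partition_big (fun Y : {set T} => inord #|Y| : 'I_#|X|.+1) predT) //=.
apply: eq_bigr => i _.
rewrite (eq_bigr (fun=> F i)) => [|Y /andP[sub /eqP defi]].
  rewrite sumr_const mulr_natl; congr (_ *+ _).
  rewrite -cards_draws; apply: eq_card => Y; rewrite !inE.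
  apply: andb_id2l => sub; apply/eqP/eqP => [<-|->]; last by rewrite inord_val.
  by rewrite inordK // ltnS subset_leq_card.
by rewrite -defi inordK // ltnS subset_leq_card.
Qed.

End SetBlockSums.

(** * Dowling lattices *)

Section EnrichedBlocks.
Variables (gT : finGroupType) (n : nat).
Implicit Types (f g : pfun gT n) (c : gT) (E F : {set pfun gT n}) (Y : {set 'I_n}).

Lemma pmulrM f c c' : pmulr (pmulr f c) c' = pmulr f (c * c')%g.
Proof. by apply/ffunP => i; rewrite !ffunE; case: (f i) => //= h; rewrite mulgA. Qed.

Lemma pmulr1 f : pmulr f 1 = f.
Proof. by apply/ffunP => i; rewrite ffunE; case: (f i) => //= h; rewrite mulg1. Qed.

Lemma pdom_pmulr f c : pdom (pmulr f c) = pdom f.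
Proof. by apply/setP => i; rewrite !inE ffunE; case: (f i). Qed.

Lemma enriched_block_refl f : f \in enriched_block f.
Proof. by apply/imsetP; exists 1%g; rewrite ?pmulr1. Qed.

Lemma enriched_block_eq f g : g \in enriched_block f -> enriched_block g = enriched_block f.
Proof.
case/imsetP => c _ ->; apply/setP => h; apply/imsetP/imsetP => -[c' _ ->].
  by exists (c * c')%g; rewrite ?pmulrM.
by exists (c^-1 * c')%g; rewrite ?pmulrM ?mulKVg.
Qed.

Lemma underlying_enriched f : underlying (enriched_block f) = pdom f.
Proof.
apply/setP => i; apply/bigcupP/idP => [[g /imsetP[c _ ->]]|fi].
  by rewrite pdom_pmulr.
by exists f; first exact: enriched_block_refl.
Qed.

Definition is_enriched E := [exists f, E == enriched_block f].

Lemma is_enrichedP E : is_enriched E -> exists f, E = enriched_block f.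
Proof. by case/existsP => f /eqP ->; exists f. Qed.

Lemma is_enriched_block f : is_enriched (enriched_block f).
Proof. by apply/existsP; exists f. Qed.

Lemma is_enriched_eq E f : is_enriched E -> f \in E -> E = enriched_block f.
Proof. by case/is_enrichedP => g -> /enriched_block_eq. Qed.

Lemma enriched_underlying E f : is_enriched E -> f \in E -> underlying E = pdom f.
Proof. by move=> eE fE; rewrite (is_enriched_eq eE fE) underlying_enriched. Qed.

Definition restricts f g := [forall i, (f i : bool) ==> (f i == g i)].

Lemma restrictsP f g : reflect (forall i, i \in pdom f -> f i = g i) (restricts f g).
Proof.
apply: (iffP forallP) => [fg i|fg i]; first by rewrite inE => fi; have /implyP/(_ fi)/eqP := fg i.
by apply/implyP => fi; rewrite fg // inE.
Qed.

Lemma restricts_refl f : restricts f f.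
Proof. exact/restrictsP. Qed.

Lemma restricts_pmulr f g c : restricts f g -> restricts (pmulr f c) (pmulr g c).
Proof.
by move/restrictsP => fg; apply/restrictsP => i; rewrite pdom_pmulr !ffunE => /fg ->.
Qed.

Lemma restricts_pdom f g : restricts f g -> pdom f \subset pdom g.
Proof.
move/restrictsP => fg; apply/subsetP => i fi.
by have := fi; rewrite !inE fg.
Qed.

Lemma restricts_trans g f h : restricts f g -> restricts g h -> restricts f h.
Proof.
move=> fg gh; apply/restrictsP => i fi; rewrite (restrictsP _ _ fg) //.
by apply: (restrictsP _ _ gh); apply: (subsetP (restricts_pdom fg)).
Qed.

Definition block_le E F := [exists f in E, exists g in F, restricts f g].

(** Right multiplication preserves [restricts] and is transitive on each block, so the
    representative of [E] may be chosen freely. *)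
Lemma block_leP E F f : is_enriched E -> is_enriched F -> f \in E ->
  reflect (exists2 g, g \in F & restricts f g) (block_le E F).
Proof.
move=> eE eF fE; apply: (iffP exists_inP) => [[f' f'E /exists_inP[g gF f'g]]|[g gF fg]].
  move: f'E fE; case/is_enrichedP: eE => f0 -> /enriched_block_eq <- /imsetP[c _ ->].
  exists (pmulr g c); last exact: restricts_pmulr.
  by rewrite (is_enriched_eq eF gF); apply: imset_f.
by exists f => //; apply/exists_inP; exists g.
Qed.

Lemma block_le_refl E : is_enriched E -> block_le E E.
Proof.
case/is_enrichedP => f ->; apply/exists_inP; exists f; first exact: enriched_block_refl.
by apply/exists_inP; exists f; [exact: enriched_block_refl | exact: restricts_refl].
Qed.

Lemma block_le_trans F E H : is_enriched E -> is_enriched F -> is_enriched H ->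
  block_le E F -> block_le F H -> block_le E H.
Proof.
move=> eE eF eH; case/exists_inP => f fE /exists_inP[g gF fg].
move=> /(block_leP eF eH gF)[h hH gh]; apply/(block_leP eE eH fE).
by exists h => //; apply: restricts_trans gh.
Qed.

Lemma block_le_underlying E F : is_enriched E -> is_enriched F -> block_le E F ->
  underlying E \subset underlying F.
Proof.
move=> eE eF /exists_inP[f fE /exists_inP[g gF fg]].
by rewrite (enriched_underlying eE fE) (enriched_underlying eF gF) restricts_pdom.
Qed.

Lemma block_le_eq E F : is_enriched E -> is_enriched F -> block_le E F ->
  underlying E = underlying F -> E = F.
Proof.
move=> eE eF /exists_inP[f fE /exists_inP[g gF /restrictsP fg]].
rewrite (enriched_underlying eE fE) (enriched_underlying eF gF) => eqd.
rewrite (is_enriched_eq eE fE) (is_enriched_eq eF gF); congr enriched_block.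
apply/ffunP => i; have [/fg//|fi] := boolP (i \in pdom f).
by have := fi; rewrite eqd in fi; move: fi; rewrite !inE; case: (f i) (g i) => [?|] [?|].
Qed.

Definition prestrict f Y : pfun gT n := [ffun i => if i \in Y then f i else None].

Lemma pdom_prestrict f Y : pdom (prestrict f Y) = pdom f :&: Y.
Proof. by apply/setP => i; rewrite !inE ffunE; case: (i \in Y); rewrite ?andbT ?andbF. Qed.

(** A block below a given block is determined by its underlying set. Hence the part of a down-set
    inside a block looks like a plain partition lattice, with no power of the group order. *)
Lemma block_le_prestrict E f : is_enriched E -> block_le E (enriched_block f) ->
  E = enriched_block (prestrict f (underlying E)).
Proof.
move=> eE /exists_inP[g gE /exists_inP[h /imsetP[c _ ->] /restrictsP gf]].
rewrite (enriched_underlying eE gE) (is_enriched_eq eE gE).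
rewrite -[RHS](@enriched_block_eq _ g) //; apply/imsetP; exists c => //.
apply/ffunP => i; rewrite !ffunE; have [/gf->|] := boolP (i \in pdom g).
  by rewrite ffunE.
by rewrite inE; case: (g i).
Qed.

Lemma prestrict_block_le f Y : block_le (enriched_block (prestrict f Y)) (enriched_block f).
Proof.
apply/exists_inP; exists (prestrict f Y); first exact: enriched_block_refl.
apply/exists_inP; exists f; first exact: enriched_block_refl.
by apply/restrictsP => i; rewrite pdom_prestrict ffunE => /setIP[_ ->].
Qed.

Lemma card_enriched_block f : pdom f != set0 -> #|enriched_block f| = #|[set: gT]|.
Proof.
case/set0Pn => i; rewrite inE => fi; rewrite /enriched_block cardsT card_imset //.
move=> c c' /ffunP/(_ i); rewrite !ffunE; case: (f i) fi => // h _ [].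
exact: mulgI.
Qed.

Lemma card_pdom Y : #|[set f : pfun gT n | pdom f == Y]| = (#|[set: gT]| ^ #|Y|)%N.
Proof.
have -> : #|[set: gT]| = #|[pred x : option gT | x]|.
  rewrite cardsT -(card_image (@Some_inj _)); apply: eq_card => -[x|]; rewrite inE /=.
    by apply/imageP; exists x.
  by apply/imageP => -[].
rewrite -(card_pffun_on None); apply: eq_card => f; rewrite inE.
apply/eqP/pffun_onP => [<-|[sub im]].
  split=> [|_ /imageP[i fi ->]]; last by rewrite inE in fi.
  by apply/supportP => i; rewrite inE; case: (f i).
apply/setP => i; rewrite inE; apply/idP/idP => [fi|iY].
  by apply: (subsetP sub); rewrite inE; case: (f i) fi.
by have := im (f i) (image_f f iY).
Qed.

(** Right multiplication acts freely on the functions on a nonempty [Y], so they fall into classes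
    of size [s]. This count is the origin of the rescaling [s x] and of the exponent [1/s]. *)
Lemma card_enriched_underlying Y : Y != set0 ->
  #|[set E : {set pfun gT n} | is_enriched E && (underlying E == Y)]| =
  (#|[set: gT]| ^ #|Y|.-1)%N.
Proof.
move=> Y0; have s_gt0 : (0 < #|[set: gT]|)%N by rewrite cardsT; apply/card_gt0P; exists 1%g.
apply/eqP; rewrite -(eqn_pmul2r s_gt0) -expnSr prednK ?card_gt0 // -card_pdom; apply/eqP.
rewrite -sum_nat_const.
rewrite -[RHS]sum1_card (partition_big (@enriched_block gT n)
   (mem [set E : {set pfun gT n} | is_enriched E && (underlying E == Y)])) /=.
  apply: eq_bigr => E; rewrite inE => /andP[eE /eqP EY].
  have [f defE] := is_enrichedP eE.
  rewrite {1}defE in EY; rewrite underlying_enriched in EY.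
  rewrite sum1_card -(card_enriched_block (f := f)) ?EY // -defE.
  apply: eq_card => g; rewrite [RHS]unfold_in /= inE; apply/idP/andP => [gE|[_ /eqP <-]].
    rewrite -(enriched_underlying eE gE) defE underlying_enriched EY eqxx.
    by rewrite -defE -(is_enriched_eq eE gE) eqxx.
  exact: enriched_block_refl.
by move=> f; rewrite !inE is_enriched_block underlying_enriched.
Qed.

End EnrichedBlocks.

(** * A description of the Dowling order without chains of covers *)

Section DowlingOrder.
Variables (gT : finGroupType) (n : nat).
Implicit Types (f g : pfun gT n) (E F : {set pfun gT n}) (u v w : dowling gT n).
Implicit Types (W : {set {set pfun gT n}}) (Z : {set 'I_n}).

Lemma is_dowling_eltE (w : {set {set pfun gT n}} * {set 'I_n}) :
  is_dowling_elt w =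
  [forall E in w.1, is_enriched E] && block_partition (@underlying gT n) (~: w.2) w.1.
Proof. by []. Qed.

Lemma dowling_enriched w E : E \in blocks w -> is_enriched E.
Proof.
by have := valP w; rewrite is_dowling_eltE => /andP[/forall_inP eW _]; apply: eW.
Qed.

Lemma dowling_partition w :
  block_partition (@underlying gT n) (~: zero_block w) (blocks w).
Proof. by have := valP w; rewrite is_dowling_eltE => /andP[]. Qed.

Lemma dowling_eq u w : zero_block u = zero_block w -> blocks u = blocks w -> u = w.
Proof.
move=> eqz eqb; apply: val_inj; move: eqz eqb.
by rewrite /zero_block /blocks; case: (val u) (val w) => [? ?] [? ?] /= -> ->.
Qed.

Lemma dowling_block_neq0 w E : E \in blocks w -> underlying E != set0.
Proof. by have /block_partitionP[_ + _] := dowling_partition w; apply. Qed.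

Lemma dowling_block_zero w E i : E \in blocks w -> i \in underlying E -> i \notin zero_block w.
Proof.
move=> Ew iE; rewrite -in_setC -(block_partition_cover (dowling_partition w)).
by apply/bigcupP; exists E.
Qed.

Lemma dowling_cover w i : i \notin zero_block w -> exists2 E, E \in blocks w & i \in underlying E.
Proof.
by rewrite -in_setC -(block_partition_cover (dowling_partition w)) => /bigcupP.
Qed.

Lemma dowling_block_inj w E F i : E \in blocks w -> F \in blocks w ->
  i \in underlying E -> i \in underlying F -> E = F.
Proof.
move=> Ew Fw iE iF; apply/eqP; apply: contraT.
have /block_partitionP[_ _ triv] := dowling_partition w.
by move/(triv _ _ Ew Fw)/disjointFr/(_ iE); rewrite iF.
Qed.

Definition below_block w E :=
  (underlying E \subset zero_block w) || [exists F in blocks w, block_le E F].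

Definition dowling_le_blocks u w :=
  (zero_block u \subset zero_block w) && [forall E in blocks u, below_block w E].

Lemma dowling_le_blocks_refl u : dowling_le_blocks u u.
Proof.
rewrite /dowling_le_blocks subxx; apply/forall_inP => E Eu; apply/orP; right.
by apply/exists_inP; exists E => //; apply/block_le_refl/(dowling_enriched Eu).
Qed.

Lemma dowling_le_blocks_trans v u w :
  dowling_le_blocks u v -> dowling_le_blocks v w -> dowling_le_blocks u w.
Proof.
case/andP=> Zuv /forall_inP uv /andP[Zvw /forall_inP vw].
rewrite /dowling_le_blocks (subset_trans Zuv Zvw); apply/forall_inP => E Eu.
have eE := dowling_enriched Eu.
have /orP[sub|/exists_inP[F Fv EF]] := uv E Eu.
  by apply/orP; left; apply: subset_trans sub Zvw.
have eF := dowling_enriched Fv.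
have subEF := block_le_underlying eE eF EF.
have /orP[sub|/exists_inP[H Hw FH]] := vw F Fv.
  by apply/orP; left; apply: subset_trans sub.
apply/orP; right; apply/exists_inP; exists H => //.
by apply: block_le_trans EF FH => //; apply: dowling_enriched Hw.
Qed.

Lemma absorb_le_blocks u v : absorb_block u v -> dowling_le_blocks u v.
Proof.
case/exists_inP => E0 E0u /andP[/eqP bv /eqP zv].
rewrite /dowling_le_blocks zv subsetUl; apply/forall_inP => E Eu.
apply/orP; have [->|neq] := eqVneq E E0; first by left; rewrite zv subsetUr.
right; apply/exists_inP; exists E; first by rewrite bv !inE neq.
exact/block_le_refl/(dowling_enriched Eu).
Qed.

Lemma merge_le_blocks u v : merge_blocks u v -> dowling_le_blocks u v.
Proof.
case/andP=> /eqP zv /existsP[f /existsP[g /existsP[c /and4P[fu gu neq /eqP bv]]]].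
rewrite /dowling_le_blocks zv subxx; apply/forall_inP => E Eu.
apply/orP; right; apply/exists_inP.
have join_v : enriched_block (pjoin f (pmulr g c)) \in blocks v by rewrite bv setU11.
have [->|nf] := eqVneq E (enriched_block f).
  exists (enriched_block (pjoin f (pmulr g c))) => //.
  apply/exists_inP; exists f; first exact: enriched_block_refl.
  apply/exists_inP; exists (pjoin f (pmulr g c)); first exact: enriched_block_refl.
  by apply/restrictsP => i; rewrite inE ffunE; case: (f i).
have [->|ng] := eqVneq E (enriched_block g).
  exists (enriched_block (pjoin f (pmulr g c))) => //.
  apply/exists_inP; exists (pmulr g c); first by apply: imset_f.
  apply/exists_inP; exists (pjoin f (pmulr g c)); first exact: enriched_block_refl.
  apply/restrictsP => i; rewrite pdom_pmulr => gi; rewrite [RHS]ffunE.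
  case fi: (f i) => [h|//]; have /eqP[] := neq.
  apply: (dowling_block_inj (i := i) fu gu); rewrite underlying_enriched //.
  by rewrite inE fi.
exists E; last exact/block_le_refl/(dowling_enriched Eu).
by rewrite bv !inE nf ng Eu orbT.
Qed.

Lemma dowling_le_sub u w : dowling_le u w -> dowling_le_blocks u w.
Proof.
case/connectP => p; elim: p u => [|v p IHp] u /=; first by move=> _ ->; apply: dowling_le_blocks_refl.
case/andP=> uv pv lastw; apply: dowling_le_blocks_trans (IHp v pv lastw).
by case/orP: uv => [/absorb_le_blocks|/merge_le_blocks].
Qed.

Lemma dowling_absorb u E : E \in blocks u ->
  exists v, blocks v = blocks u :\ E /\ zero_block v = zero_block u :|: underlying E.
Proof.
move=> Eu; have ok : is_dowling_elt (blocks u :\ E, zero_block u :|: underlying E).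
  rewrite is_dowling_eltE /=; apply/andP; split.
    by apply/forall_inP => F /setD1P[_ /dowling_enriched].
  have := dowling_partition u; rewrite (block_partitionD1 _ _ Eu) => /and3P[_ _].
  by rewrite setDE -setCU.
by exists (Sub _ ok); rewrite /blocks /zero_block SubK.
Qed.

Lemma dowling_merge u f g c : enriched_block f \in blocks u -> enriched_block g \in blocks u ->
  enriched_block f != enriched_block g ->
  exists v, blocks v = enriched_block (pjoin f (pmulr g c))
                     |: (blocks u :\ enriched_block f :\ enriched_block g)
            /\ zero_block v = zero_block u.
Proof.
move=> fu gu neq; set h := pjoin _ _; set W := _ :\ _.
have domh : pdom h = pdom f :|: pdom g.
  by apply/setP => i; rewrite !inE !ffunE; case: (f i); case: (g i).
have := dowling_partition u; rewrite (block_partitionD1 _ _ fu) => /and3P[f0 fsub].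
have gu' : enriched_block g \in blocks u :\ enriched_block f by rewrite !inE eq_sym neq.
rewrite (block_partitionD1 _ _ gu') -/W => /and3P[g0 gsub bpW].
have hW : enriched_block h \notin W.
  apply/negP => hW; have /set0Pn[i fi] := f0.
  have := block_partition_cover bpW => /setP/(_ i); rewrite !inE fi /= andbF => /negbT/bigcupP.
  apply; exists (enriched_block h) => //; rewrite underlying_enriched domh inE.
  by rewrite underlying_enriched in fi; rewrite fi.
have ok : is_dowling_elt (enriched_block h |: W, zero_block u).
  rewrite is_dowling_eltE /=; apply/andP; split.
    apply/forall_inP => F /setU1P[->|/setD1P[_ /setD1P[_ /dowling_enriched]]//].
    exact: is_enriched_block.
  rewrite !underlying_enriched in f0 fsub g0 gsub bpW.
  rewrite (block_partitionD1 _ _ (setU11 _ _)) setU1K // underlying_enriched domh.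
  rewrite -setDDl bpW andbT subUset fsub (subset_trans gsub (subsetDl _ _)) !andbT.
  by apply: contraNneq f0 => h0; have := subsetUl (pdom f) (pdom g); rewrite h0 subset0.
by exists (Sub _ ok); rewrite /blocks /zero_block SubK.
Qed.

(** To go up from [u] to [w], absorb a block that lies in the zero block of [w], or else merge two
    blocks lying below the same block of [w]. Both moves stay below [w] and lower the number of
    blocks; when neither is possible, [u = w]. *)
Lemma dowling_leE u w : dowling_le u w = dowling_le_blocks u w.
Proof.
apply/idP/idP => [|uw]; first exact: dowling_le_sub.
have [k] := ubnP #|blocks u|; elim: k u uw => // k IHk u uw; rewrite ltnS => leuk.
have [Zuw /forall_inP below] := andP uw.
have [/exists_inP[E Eu EZ]|noabsorb] := boolP [exists E in blocks u, underlying E \subset zero_block w].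
  have [v [bv zv]] := dowling_absorb Eu.
  apply: (@connect_trans _ _ v).
    by apply: connect1; apply/orP; left; apply/exists_inP; exists E; rewrite ?bv ?zv ?eqxx.
  apply: IHk; last by apply: leq_trans leuk; rewrite bv [X in (_ < X)%N](cardsD1 E) Eu.
  rewrite /dowling_le_blocks zv subUset Zuw EZ; apply/forall_inP => F.
  by rewrite bv => /setD1P[_ /below].
have above E : E \in blocks u -> exists2 F, F \in blocks w & block_le E F.
  move=> Eu; have /orP[EZ|/exists_inP//] := below E Eu.
  by case/negP: noabsorb; apply/exists_inP; exists E.
have [/exists_inP[E Eu /exists_inP[E' E'u /andP[neq /exists_inP[F Fw /andP[EF E'F]]]]]|nomerge] :=
  boolP [exists E in blocks u, exists E' in blocks u, (E != E') &&
           [exists F in blocks w, block_le E F && block_le E' F]].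
  have [eE eE' eF] := And3 (dowling_enriched Eu) (dowling_enriched E'u) (dowling_enriched Fw).
  have [f defE] := is_enrichedP eE.
  have fE : f \in E by rewrite defE enriched_block_refl.
  have /(block_leP eE eF fE)[g gF fg] := EF.
  have [f' defE'] := is_enrichedP eE'.
  have f'E' : f' \in E' by rewrite defE' enriched_block_refl.
  have /(block_leP eE' eF f'E')[g' g'F f'g'] := E'F.
  (* The representatives [g] and [g'] of [F] differ by a constant [c]; with this [c], [f] and the
     multiple of [f'] are restrictions of the same [g], so their join is one too. *)
  have [c f'g] : exists c, restricts (pmulr f' c) g.
    have := gF; rewrite (is_enriched_eq eF g'F) => /imsetP[c _ ->].
    by exists c; apply: restricts_pmulr.
  rewrite defE defE' in Eu E'u neq.
  have [v [bv zv]] := dowling_merge c Eu E'u neq.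
  apply: (@connect_trans _ _ v).
    apply: connect1; apply/orP; right; rewrite /merge_blocks zv eqxx; apply/existsP; exists f.
    apply/existsP; exists f'; apply/existsP; exists c.
    by rewrite Eu E'u neq bv eqxx.
  apply: IHk.
    rewrite /dowling_le_blocks zv Zuw; apply/forall_inP => H.
    rewrite bv => /setU1P[->|/setD1P[_ /setD1P[_ /below//]]].
    apply/orP; right; apply/exists_inP; exists F => //.
    apply/exists_inP; exists (pjoin f (pmulr f' c)); first exact: enriched_block_refl.
    apply/exists_inP; exists g => //; apply/restrictsP => i.
    rewrite inE !ffunE; case fi: (f i) => [h|].
      by move=> _; rewrite -(restrictsP _ _ fg) ?inE fi.
    have /restrictsP/(_ i) := f'g; rewrite inE ffunE; exact.
  apply: leq_trans leuk; rewrite bv.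
  have E'u2 : enriched_block f' \in blocks u :\ enriched_block f.
    by rewrite !inE eq_sym neq.
  rewrite [X in (_ < X)%N](cardsD1 (enriched_block f)) Eu.
  rewrite [X in (_ < _ + X)%N](cardsD1 (enriched_block f')) E'u2 !add1n ltnS.
  by rewrite cardsU1; case: (_ \notin _).
suff -> : u = w by apply: connect0.
have subF E F : E \in blocks u -> F \in blocks w -> block_le E F -> underlying E \subset underlying F.
  by move=> /dowling_enriched eE /dowling_enriched eF; apply: block_le_underlying.
have eqZ : zero_block u = zero_block w.
  apply/eqP; rewrite eqEsubset Zuw; apply/subsetP => i iw; apply: contraT => iu.
  have [E Eu iE] := dowling_cover iu; have [F Fw EF] := above E Eu.
  by have := dowling_block_zero Fw (subsetP (subF _ _ Eu Fw EF) i iE); rewrite iw.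
(* Since the zero blocks agree, each point of [F] lies in a block of [u] below [F]; one different
   from [E] could be merged with [E]. *)
have sub_blocks E : E \in blocks u -> E \in blocks w.
  move=> Eu; have [F Fw EF] := above E Eu.
  suff -> : E = F by [].
  have subEF := subF E F Eu Fw EF.
  apply: (block_le_eq _ _ EF); [exact: dowling_enriched Eu | exact: dowling_enriched Fw | ].
  apply/eqP; rewrite eqEsubset subEF; apply/subsetP => i iF.
  have iu : i \notin zero_block u by rewrite eqZ; apply: dowling_block_zero Fw iF.
  have [E' E'u iE'] := dowling_cover iu; have [F' F'w E'F'] := above E' E'u.
  have eqF : F = F' by apply: (dowling_block_inj Fw F'w iF); apply: (subsetP (subF _ _ E'u F'w E'F')).
  have [->//|neq] := eqVneq E E'.
  case/negP: nomerge; apply/exists_inP; exists E => //; apply/exists_inP; exists E' => //.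
  by rewrite neq; apply/exists_inP; exists F; rewrite // EF eqF.
apply: dowling_eq => //; apply/setP => F; apply/idP/idP => [/sub_blocks//|Fw].
have /set0Pn[i iF] := dowling_block_neq0 Fw.
have iu : i \notin zero_block u by rewrite eqZ; apply: dowling_block_zero Fw iF.
have [E Eu iE] := dowling_cover iu.
by rewrite (dowling_block_inj Fw (sub_blocks E Eu) iF iE).
Qed.

End DowlingOrder.

(** * Sums of multiplicative functions over down-sets of the Dowling lattice *)

Section DowlingSum.
Variables (gT : finGroupType) (n : nat) (R : comNzRingType) (A B : nat -> R).
Implicit Types (E F : {set pfun gT n}) (u w : dowling gT n) (Z Y : {set 'I_n}).
Local Notation s := #|[set: gT]|.

(** The value 0 encodes the order relation in the weights, so that [block_sum] may range over
    arbitrary families of sets of partial functions. *)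
Definition below_weight w E : R :=
  if is_enriched E && below_block w E then B #|underlying E| else 0.

(** Once the zero block [Z] is fixed, being below [w] is a condition on each block separately. *)
Lemma dowling_sum_zero w :
  \sum_(u | dowling_le u w) A #|zero_block u| * \prod_(E in blocks u) B #|underlying E| =
  \sum_(Z : {set 'I_n} | Z \subset zero_block w)
     A #|Z| * block_sum (@underlying gT n) (below_weight w) (~: Z).
Proof.
under [RHS]eq_bigr => Z _ do rewrite big_distrr /=.
rewrite pair_big_dep /=.
rewrite (bigID (fun p : {set 'I_n} * {set {set pfun gT n}} => [forall E in p.2, is_enriched E && below_block w E])) /=.
rewrite [X in _ + X]big1 ?addr0 => [|[Z W] /= /andP[_ /forall_inPn[E EW bad]]]; last first.
  by rewrite (big_setD1 E EW) /= {1}/below_weight (negPf bad) mul0r mulr0.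
rewrite [RHS](reindex_omap (fun u : dowling gT n => (zero_block u, blocks u))
   (fun p => insub (p.2, p.1))) /=; last first.
  move=> [Z W] /= /andP[/andP[_ bpW] /forall_inP below].
  case: insubP => [u _ uE|/negP[]] /=; first by rewrite /zero_block /blocks uE.
  rewrite is_dowling_eltE /= bpW andbT; apply/forall_inP => E /below.
  by case/andP.
apply: eq_big => [u|u]; last first.
  rewrite dowling_leE => /andP[_ /forall_inP below]; congr (_ * _).
  by apply: eq_bigr => E Eu; rewrite /below_weight (dowling_enriched Eu) below.
have -> : insub (blocks u, zero_block u) = Some u.
  by rewrite /blocks /zero_block -surjective_pairing valK.
rewrite dowling_leE /dowling_le_blocks dowling_partition andbT eqxx andbT; congr (_ && _).
by apply: eq_forallb_in => E Eu; rewrite (dowling_enriched Eu).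
Qed.

Definition total_weight w Y : R := \sum_(E : {set pfun gT n} | underlying E == Y) below_weight w E.

Lemma total_weight0 w Y :
  (forall E, underlying E = Y -> is_enriched E -> ~~ below_block w E) ->
  total_weight w Y = 0.
Proof.
move=> none; apply: big1 => E /eqP EY; rewrite /below_weight.
by case: ifP => // /andP[eE]; rewrite (negPf (none E EY eE)).
Qed.

Lemma below_block_meet w E F : is_enriched E -> below_block w E ->
  F \in blocks w -> ~~ [disjoint underlying E & underlying F] ->
  block_le E F.
Proof.
move=> eE bE Fw /pred0Pn[i /= /andP[iE iF]].
case/orP: bE => [sub|/exists_inP[F' F'w EF']].
  by have := dowling_block_zero Fw iF; rewrite (subsetP sub i iE).
have iF' : i \in underlying F'.
  exact: subsetP (block_le_underlying eE (dowling_enriched F'w) EF') i iE.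
by rewrite (dowling_block_inj Fw F'w iF iF').
Qed.

Lemma total_weight_zero w Y : Y != set0 -> Y \subset zero_block w ->
  total_weight w Y = s%:R ^+ #|Y|.-1 * B #|Y|.
Proof.
move=> Y0 sub; rewrite -natrX -card_enriched_underlying // mulr_natl -sumr_const.
rewrite /total_weight [LHS]big_mkcond [RHS]big_mkcond /=; apply: eq_bigr => E _.
rewrite inE /below_weight /below_block; have [EY|] := eqVneq (underlying E) Y; last by rewrite andbF.
by rewrite EY sub !andbT.
Qed.

Lemma total_weight_block w F Y : F \in blocks w -> Y != set0 -> Y \subset underlying F ->
  total_weight w Y = B #|Y|.
Proof.
move=> Fw Y0 sub; have eF := dowling_enriched Fw; have [f defF] := is_enrichedP eF.
have domY : underlying (enriched_block (prestrict f Y)) = Y.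
  rewrite underlying_enriched pdom_prestrict; apply/setIidPr.
  by move: sub; rewrite defF underlying_enriched.
rewrite /total_weight (bigD1 (enriched_block (prestrict f Y))) ?domY //=.
rewrite big1 ?addr0 => [|E /andP[/eqP EY neq]]; last first.
  rewrite /below_weight; case: ifP => // /andP[eE bE]; case/eqP: neq.
  have meet : ~~ [disjoint underlying E & underlying F].
    have /set0Pn[i iY] := Y0; apply/pred0Pn; exists i.
    by rewrite /= EY iY (subsetP sub).
  have := below_block_meet eE bE Fw meet; rewrite {1}defF => /(block_le_prestrict eE).
  by rewrite EY.
rewrite /below_weight is_enriched_block domY /= ifT //; apply/orP; right.
by apply/exists_inP; exists F => //; rewrite {1}defF prestrict_block_le.
Qed.

Lemma total_weight_zero_meet w Y :
  ~~ [disjoint Y & zero_block w] -> ~~ [disjoint Y & ~: zero_block w] ->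
  total_weight w Y = 0.
Proof.
move=> /pred0Pn[i /= /andP[iY iw]] /pred0Pn[j /= /andP[jY]]; rewrite inE => jw.
apply: total_weight0 => E EY eE; apply/negP => bE.
have [sub|/exists_inP[F Fw EF]] := orP bE.
  by rewrite EY in sub; rewrite (subsetP sub j jY) in jw.
have := block_le_underlying eE (dowling_enriched Fw) EF; rewrite EY => sub.
by have := dowling_block_zero Fw (subsetP sub i iY); rewrite iw.
Qed.

Lemma total_weight_block_meet w Y Z Z' :
  Z \in [set underlying E | E in blocks w] -> Z' \in [set underlying E | E in blocks w] ->
  ~~ [disjoint Y & Z] -> ~~ [disjoint Y & Z'] -> Z != Z' -> total_weight w Y = 0.
Proof.
move=> /imsetP[F Fw ->] /imsetP[F' F'w ->] YF YF' neq.
apply: total_weight0 => E EY eE; apply/negP => bE.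
rewrite -EY in YF YF'; have EF := below_block_meet eE bE Fw YF.
have sub := block_le_underlying eE (dowling_enriched Fw) EF.
have /pred0Pn[i /= /andP[iE iF']] := YF'.
by rewrite (dowling_block_inj Fw F'w (subsetP sub i iE) iF') eqxx in neq.
Qed.

(** A new zero block [Z] is chosen inside that of [w]; no block below [w] crosses the zero block or
    two blocks of [w], so the remaining sum factors. Every enrichment is allowed inside the zero
    block, whence the powers of [s], and a single one inside a block of [w]. *)
Lemma dowling_down_sum w :
  \sum_(u | dowling_le u w) A #|zero_block u| * \prod_(E in blocks u) B #|underlying E| =
  (\sum_(i < #|zero_block w|.+1) 'C(#|zero_block w|, i)%:R *
     (A i * partition_sum (fun j => s%:R ^+ j.-1 * B j) (#|zero_block w| - i)))
  * \prod_(F in blocks w) partition_sum B #|underlying F|.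
Proof.
rewrite dowling_sum_zero.
rewrite -(sum_subset (zero_block w)
  (fun i => A i * partition_sum (fun j => s%:R ^+ j.-1 * B j) (#|zero_block w| - i))).
rewrite big_distrl /=; apply: eq_bigr => Z sub; rewrite -mulrA; congr (_ * _).
rewrite block_sum_dom -/(total_weight w).
have -> : ~: Z = (zero_block w :\: Z) :|: ~: zero_block w.
  by apply/setP => i; rewrite !inE; have [/(subsetP sub)->|_] := boolP (i \in Z);
     rewrite ?orbF //= orbN.
rewrite block_sumU; last 2 first.
- by rewrite disjoint_sym -setI_eq0 setDE setIA [~: _ :&: _]setIC setICr set0I.
- move=> Y nZ; apply: total_weight_zero_meet; apply: contra nZ; apply: disjointWr.
  exact: subsetDl.
congr (_ * _).
  rewrite -(cardsDS sub) -block_sum_card; apply: eq_block_sum => Y Y0 subY.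
  by apply: total_weight_zero => //; apply: subset_trans subY (subsetDl _ _).
have bpw := dowling_partition w; have /andP[_ partw] := bpw.
rewrite (block_sum_partition partw); last exact: total_weight_block_meet.
rewrite big_imset /=; last first.
  move=> E F Ew Fw EF; have /set0Pn[i iE] := dowling_block_neq0 Ew.
  by apply: (dowling_block_inj Ew Fw iE); rewrite -EF.
apply: eq_bigr => F Fw; rewrite -block_sum_card; apply: eq_block_sum => Y Y0 subY.
exact: total_weight_block Fw Y0 subY.
Qed.

End DowlingSum.

(** * Directly indecomposable elements *)

Section ConnectedElements.
Variables (T : finType) (le : rel T).

Definition atom_over m a : bool :=
  [&& le m a, a != m & [forall y, le m y && le y a ==> (y == m) || (y == a)]].

(* In a product of intervals, the connected elements over the bottom [m] lie in
   one factor: otherwise the atoms split between two smaller elements. *)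
Definition connected_over m z : bool :=
  [&& le m z, z != m & [forall u, forall v,
     [&& le m u, le u z, le m v, le v z &
         [forall a, atom_over m a && le a z ==> le a u || le a v]]
     ==> (u == z) || (v == z)]].

Definition max_connected m x z : bool :=
  [&& connected_over m z, le z x
    & [forall z', [&& connected_over m z', le z' x & le z z'] ==> (z' == z)]].

(** The cardinality of [[m, z]] tells the kinds of indecomposable factors apart. It is compared in
    [rat] because it is going to be a value of [bell]. *)
Definition nb_max_connected m x (b : rat) : nat :=
  #|[set z | max_connected m x z && (#|[set y | le m y && le y z]|%:R == b)]|.

Lemma atom_overP m a :
  reflect [/\ le m a, a <> m & forall y, le m y -> le y a -> y <> m -> y = a]
          (atom_over m a).
Proof.
apply: (iffP and3P) => [[ma /eqP nam /forallP ata]|[ma nam ata]].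
  split=> // y my ya nym; have := ata y; rewrite my ya /=.
  by case/orP => /eqP.
split=> //; first exact/eqP.
apply/forallP => y; apply/implyP => /andP[my ya]; have [//|/eqP nym] := eqVneq y m.
by rewrite (ata y) // eqxx orbT.
Qed.

Lemma connected_overP m z :
  reflect [/\ le m z, z <> m & forall u v, le m u -> le u z -> le m v -> le v z ->
             (forall a, atom_over m a -> le a z -> le a u || le a v) -> u = z \/ v = z]
          (connected_over m z).
Proof.
apply: (iffP and3P) => [[mz /eqP nzm /forallP conn]|[mz nzm conn]].
  split=> // u v mu uz mv vz at_uv; have /forallP/(_ v)/implyP := conn u.
  rewrite mu uz mv vz /= => h; have /orP[/eqP->|/eqP->] : (u == z) || (v == z); [|by left|by right].
  by apply: h; apply/forallP => a; apply/implyP => /andP[]; apply: at_uv.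
split=> //; first exact/eqP.
apply/forallP => u; apply/forallP => v; apply/implyP => /and5P[mu uz mv vz /forallP at_uv].
have [|->|->] := conn u v mu uz mv vz; rewrite ?eqxx ?orbT //.
by move=> a aa az; have /implyP := at_uv a; rewrite aa az => /(_ isT).
Qed.

End ConnectedElements.

(** * Invariance of connectedness under order embeddings *)

Section ConnectedTransport.
Variables (S T : finType) (leS : rel S) (leT : rel T) (f : S -> T).
Hypotheses (f_inj : injective f) (f_mono : {mono f : x y / leS x y >-> leT x y}).
Hypothesis leT_trans : transitive leT.
Variables m x : S.
(** Surjectivity is only asked onto the interval, so that inclusions of ideals, of intervals and of
    factors of a product are covered along with isomorphisms. *)
Hypothesis f_onto : forall t, leT (f m) t -> leT t (f x) -> exists y, t = f y.

Lemma atom_over_image a : leS a x -> atom_over leT (f m) (f a) = atom_over leS m a.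
Proof.
move=> ax; apply/atom_overP/atom_overP; rewrite f_mono => -[ma nam ata]; split=> //.
- by move=> eqa; apply: nam; rewrite eqa.
- by move=> y my ya nym; apply: f_inj; apply: ata; rewrite ?f_mono // => /f_inj.
- by move/f_inj.
move=> t mt ta; have [|y def_t] := f_onto mt; first by apply: leT_trans ta _; rewrite f_mono.
rewrite def_t !f_mono in mt ta *; move=> ntm; rewrite (ata y) // => eqy.
by apply: ntm; rewrite eqy.
Qed.

Lemma connected_over_image z : leS z x ->
  connected_over leT (f m) (f z) = connected_over leS m z.
Proof.
move=> zx; have below_z t : leT t (f z) -> leT t (f x).
  by move=> tz; apply: leT_trans tz _; rewrite f_mono.
have belowS_z y : leS y z -> leS y x.
  by rewrite -!f_mono => /below_z.
apply/connected_overP/connected_overP; rewrite f_mono => -[mz nzm conn]; split=> //.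
- by move=> eqz; apply: nzm; rewrite eqz.
- move=> u v mu uz mv vz at_uv; have [|||||/f_inj->|/f_inj->] := conn (f u) (f v);
    rewrite ?f_mono //; [|by left|by right].
  move=> t at_t tz; have /atom_overP[mt _ _] := at_t.
  have [y def_t] := f_onto mt (below_z t tz).
  rewrite def_t !f_mono in at_t tz *; apply: at_uv => //.
  by rewrite -atom_over_image // belowS_z.
- by move/f_inj.
move=> u' v' mu uz mv vz; have [u def_u] := f_onto mu (below_z _ uz).
have [v def_v] := f_onto mv (below_z _ vz).
rewrite {u'}def_u {v'}def_v !f_mono in mu uz mv vz *; move=> at_uv.
have [|->|->] := conn u v mu uz mv vz; [|by left|by right].
move=> a at_a az; rewrite -!(f_mono a); apply: at_uv; last by rewrite f_mono.
by rewrite atom_over_image // belowS_z.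
Qed.

Lemma max_connected_image z : leS z x ->
  max_connected leT (f m) (f x) (f z) = max_connected leS m x z.
Proof.
move=> zx; rewrite /max_connected f_mono connected_over_image //; congr [&& _, _ & _].
apply/forallP/forallP => [mx y|mx t].
  have /implyP := mx (f y); rewrite !f_mono => h; apply/implyP => /and3P[cy yx zy].
  by rewrite -(inj_eq f_inj); apply: h; rewrite connected_over_image // cy yx.
apply/implyP => /and3P[ct tx zt]; have /and3P[mt _ _] := ct.
have [y def_t] := f_onto mt tx; rewrite {t}def_t !f_mono in ct tx zt mt *.
rewrite (inj_eq f_inj); have /implyP := mx y; apply.
by rewrite -connected_over_image // ct tx.
Qed.

Lemma card_interval_image z : leS z x ->
  #|[set t | leT (f m) t && leT t (f z)]| = #|[set y | leS m y && leS y z]|.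
Proof.
move=> zx; rewrite -(card_imset _ f_inj); apply: eq_card => t; rewrite inE.
apply/andP/imsetP => [[mt tz]|[y + ->]]; last by rewrite inE !f_mono => /andP.
have [|y def_t] := f_onto mt; first by apply: leT_trans tz _; rewrite f_mono.
by exists y; rewrite // inE -!f_mono -def_t mt.
Qed.

Lemma nb_max_connected_image b :
  nb_max_connected leT (f m) (f x) b = nb_max_connected leS m x b.
Proof.
rewrite /nb_max_connected -(card_imset _ f_inj); apply: eq_card => t; rewrite inE.
apply/andP/imsetP => [[mt ct]|[z + ->]]; last first.
  rewrite inE => /andP[mz cz]; have /and3P[_ zx _] := mz.
  by rewrite max_connected_image // card_interval_image.
have /and3P[/and3P[fmt _ _] tx _] := mt; have [z def_t] := f_onto fmt tx.
rewrite {t}def_t !f_mono in mt ct fmt tx *; exists z => //.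
by rewrite inE -max_connected_image // -card_interval_image // mt.
Qed.

End ConnectedTransport.

(** * Connected elements of a product *)

Section ConnectedProduct.
Variables (d : Order.disp_t) (K : finType) (T : K -> finPOrderType d).
Local Notation prodT := {dffun forall p, T p}.
Implicit Types (u v z m x : prodT) (p q : K).

Definition prod_le : rel prodT := fun u v => [forall p, (u p <= v p)%O].

Lemma prod_leP u v : reflect (forall p, (u p <= v p)%O) (prod_le u v).
Proof. exact: forallP. Qed.

Lemma prod_le_trans : transitive prod_le.
Proof.
move=> v u w /prod_leP uv /prod_leP vw; apply/prod_leP => p.
exact: le_trans (uv p) (vw p).
Qed.

Variables m x : prodT.
Hypothesis le_mx : prod_le m x.

Definition embed p (t : T p) : prodT := finfun (dfwith m t).

Lemma embedE p (t : T p) : embed t p = t.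
Proof. by rewrite ffunE dfwith_in. Qed.

Lemma embed_neq p q (t : T p) : p != q -> embed t q = m q.
Proof. by move=> neq; rewrite ffunE dfwith_out. Qed.

Lemma embed_bot p : embed (m p) = m.
Proof.
by apply/ffunP => q; have [<-|neq] := eqVneq p q; rewrite ?embedE ?embed_neq.
Qed.

Lemma embed_inj p : injective (@embed p).
Proof. by move=> t t' /ffunP/(_ p); rewrite !embedE. Qed.

Lemma embed_le p (t t' : T p) : prod_le (embed t) (embed t') = (t <= t')%O.
Proof.
apply/prod_leP/idP => [/(_ p)|le_t q]; first by rewrite !embedE.
by have [<-|neq] := eqVneq p q; rewrite ?embedE ?embed_neq.
Qed.

Lemma embed_onto p (t : T p) z : prod_le (embed (m p)) z -> prod_le z (embed t) ->
  exists y : T p, z = embed y.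
Proof.
rewrite embed_bot => /prod_leP mz /prod_leP zt; exists (z p); apply/ffunP => q.
have [<-|neq] := eqVneq p q; first by rewrite embedE.
by rewrite embed_neq //; apply/le_anti; rewrite mz; have := zt q; rewrite embed_neq // => ->.
Qed.

Lemma embed_le_r p (t : T p) z : prod_le m z -> prod_le (embed t) z = (t <= z p)%O.
Proof.
move/prod_leP => mz; apply/prod_leP/idP => [/(_ p)|le_t q]; first by rewrite embedE.
by have [<-|neq] := eqVneq p q; rewrite ?embedE ?embed_neq.
Qed.

Lemma connected_embed p (t : T p) :
  connected_over prod_le m (embed t) = connected_over <=%O (m p) t.
Proof.
rewrite -{1}(embed_bot p).
by apply: (connected_over_image (@embed_inj p) (@embed_le p) prod_le_trans (@embed_onto p t)).
Qed.

Lemma connected_prod z : connected_over prod_le m z -> exists p, exists t : T p, z = embed t.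
Proof.
case/connected_overP => /prod_leP mz nzm conn.
have [/forallP zm|] := boolP [forall p, z p == m p].
  by case: nzm; apply/ffunP => p; apply/eqP; exact: zm.
rewrite negb_forall => /existsP[p zp]; exists p; exists (z p).
(* An atom moves one coordinate only, so it is below [embed (z p)] or below [v]. As [v] differs from
   [z] at [p], connectedness forces [z = embed (z p)]. *)
pose v : prodT := [ffun q => if q == p then m q else z q].
have := conn (embed (z p)) v; case.
- by rewrite -{1}(embed_bot p) embed_le.
- by rewrite embed_le_r //; apply/prod_leP.
- by apply/prod_leP => q; rewrite ffunE; case: ifP.
- by apply/prod_leP => q; rewrite ffunE; case: ifP.
- move=> a /atom_overP[/prod_leP ma nam ata] /prod_leP az.
  have [ap|nap] := eqVneq (a p) (m p).
    apply/orP; right; apply/prod_leP => q; rewrite ffunE.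
    by case: eqP => [->|_]; rewrite ?ap.
  rewrite -(ata (embed (a p))); first by rewrite embed_le az.
  + by rewrite -{1}(embed_bot p) embed_le.
  + by rewrite embed_le_r //; apply/prod_leP.
  by move/ffunP/(_ p); rewrite embedE; apply/eqP.
- by [].
by move/ffunP/(_ p); rewrite ffunE eqxx => zpm; rewrite -zpm eqxx in zp.
Qed.

Lemma max_connected_embed p (t : T p) :
  max_connected prod_le m x (embed t) = max_connected <=%O (m p) (x p) t.
Proof.
rewrite /max_connected connected_embed embed_le_r //; apply: andb_id2l => ct.
congr (_ && _); apply/forallP/forallP => [mx t'|mx z].
  have /implyP := mx (embed t'); rewrite connected_embed embed_le_r // embed_le.
  by rewrite (inj_eq (@embed_inj p)) => h; apply/implyP.
apply/implyP => /and3P[cz]; have [q [t' def_z]] := connected_prod cz.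
rewrite {z}def_z connected_embed in cz * => le1 le2.
have eq_pq : p = q.
  apply/eqP; apply: contraT => neq; have /and3P[mt ntm _] := ct.
  have /prod_leP/(_ p) := le2; rewrite embedE embed_neq 1?eq_sym // => tm.
  by case/eqP: ntm; apply/le_anti; rewrite tm.
move: t' cz le1 le2; rewrite -eq_pq => t' ct'; rewrite embed_le_r // embed_le => t'x tt'.
by rewrite (inj_eq (@embed_inj p)); have /implyP := mx t'; apply; rewrite ct' t'x.
Qed.

Lemma card_interval_embed p (t : T p) :
  #|[set z | prod_le m z && prod_le z (embed t)]| = #|[set y | (m p <= y)%O && (y <= t)%O]|.
Proof.
rewrite -{1}(embed_bot p).
by apply: (card_interval_image (@embed_inj p) (@embed_le p) prod_le_trans (@embed_onto p t)).
Qed.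

Lemma nb_max_connected_prod b :
  nb_max_connected prod_le m x b =
  (\sum_p nb_max_connected (<=%O : rel (T p)) (m p) (x p) b)%N.
Proof.
pose good p (t : T p) := max_connected <=%O (m p) (x p) t &&
   (#|[set y | (m p <= y)%O && (y <= t)%O]|%:R == b).
transitivity #|[set u : {p : K & T p} | good (tag u) (tagged u)]|; last first.
  rewrite -sum1_card; under [RHS]eq_bigr => p _ do rewrite /nb_max_connected -sum1_card.
  rewrite sig_big_dep /=; apply: eq_bigl => u; by rewrite !inE.
rewrite -(card_in_imset (f := fun u : {p : K & T p} => embed (tagged u))).
  apply: eq_card => z; rewrite inE; apply/andP/imsetP => [[mz cz]|[[p t] + ->]].
    have /and3P[conn _ _] := mz; have [p [t def_z]] := connected_prod conn.
    exists (Tagged T t) => //; rewrite inE /good /=.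
    by rewrite -max_connected_embed -card_interval_embed -def_z mz.
  by rewrite inE /good /= -max_connected_embed -card_interval_embed => /andP.
move=> [p t] [q t']; rewrite !inE /= => /andP[/and3P[/and3P[_ ntm _] _ _] _] _ eq_e.
have eq_pq : p = q.
  apply/eqP; apply: contraT => neq; case/eqP: ntm.
  by have /ffunP/(_ p) := eq_e; rewrite embedE embed_neq 1?eq_sym.
move: t' eq_e; rewrite -eq_pq => t' /embed_inj ->//.
Qed.

End ConnectedProduct.

(** * Partition lattices *)

Section PartitionLattice.
Variable n : nat.
Implicit Types (P : set_partition n) (i j : 'I_n) (Y Z : {set 'I_n}).

Definition same_block P : rel 'I_n := fun i j => j \in pblock (val P) i.

Lemma same_block_equiv P : equivalence_rel (same_block P).
Proof. by move=> i j k; apply: (pblock_equivalence (valP P)). Qed.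

Lemma same_block_refl P : reflexive (same_block P).
Proof. by have /equivalence_relP[] := same_block_equiv P. Qed.

Lemma same_block_left P : left_transitive (same_block P).
Proof. by have /equivalence_relP[] := same_block_equiv P. Qed.

Lemma same_block_sym P : symmetric (same_block P).
Proof.
move=> i j; apply/idP/idP => h.
  by rewrite -(same_block_left h) same_block_refl.
by rewrite -(same_block_left h) same_block_refl.
Qed.

Lemma same_block_trans P : transitive (same_block P).
Proof. by move=> j i k /same_block_left ->. Qed.

Lemma set_partition_cover P i : i \in cover (val P).
Proof. by rewrite (cover_partition (valP P)) inE. Qed.

Lemma set_partition_triv P : trivIset (val P).
Proof. exact: partition_trivIset (valP P). Qed.

Lemma set_partition_pblock P Y i : Y \in val P -> i \in Y -> pblock (val P) i = Y.
Proof. exact: def_pblock (set_partition_triv P). Qed.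

Lemma refinesP P P' :
  reflect (forall i j, same_block P i j -> same_block P' i j) (refines P P').
Proof.
apply: (iffP forall_inP) => [ref i j ij|ref Y YP].
  have /exists_inP[C CP' sub] := ref _ (pblock_mem (set_partition_cover P i)).
  have iC : i \in C by apply: (subsetP sub); apply: same_block_refl.
  by rewrite /same_block (set_partition_pblock CP' iC) (subsetP sub).
have /set0Pn[i iY] := partition_neq0 (valP P) YP.
apply/exists_inP; exists (pblock (val P') i); first exact: pblock_mem (set_partition_cover P' i).
by apply/subsetP => j jY; apply: ref; rewrite /same_block (set_partition_pblock YP iY).
Qed.

Lemma same_block_inj P P' : same_block P =2 same_block P' -> P = P'.
Proof.
move=> eqP'; apply: val_inj.
rewrite -(equivalence_partition_pblock (valP P)) -(equivalence_partition_pblock (valP P')).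
by apply: eq_imset => i; apply/setP => j; rewrite !inE; apply: eqP'.
Qed.

Lemma refines_trans : transitive (@refines n).
Proof.
move=> P2 P1 P3 /refinesP h12 /refinesP h23; apply/refinesP => i j /h12.
exact: h23.
Qed.

Lemma refines_anti P P' : refines P P' -> refines P' P -> P = P'.
Proof.
move=> /refinesP h /refinesP h'; apply: same_block_inj => i j.
by apply/idP/idP => [/h|/h'].
Qed.

Lemma set_partition_of (r : rel 'I_n) : equivalence_rel r ->
  exists P, same_block P =2 r.
Proof.
move=> er; have er' : {in [set: 'I_n] & &, equivalence_rel r} by move=> i j k _ _ _; apply: er.
exists (exist _ (equivalence_partition r [set: 'I_n]) (equivalence_partitionP er')) => i j.
by rewrite /same_block /= (pblock_equivalence_partition er') ?inE.
Qed.

Definition one_block_rel Y : rel 'I_n := fun i j => (i == j) || (i \in Y) && (j \in Y).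

Lemma one_block_equiv Y : equivalence_rel (one_block_rel Y).
Proof.
apply/equivalence_relP; split=> [i|i j]; rewrite /one_block_rel ?eqxx //.
case/orP => [/eqP-> //|/andP[iY jY] k]; rewrite iY jY /=.
have [<-|_] := eqVneq i k; first by rewrite iY /= orbT.
by have [<-|_] := eqVneq j k; rewrite ?jY ?orbT.
Qed.

Lemma one_block_exists Y : exists P, [forall i, forall j, same_block P i j == one_block_rel Y i j].
Proof.
have [P sameP] := set_partition_of (one_block_equiv Y).
by exists P; apply/forallP => i; apply/forallP => j; rewrite sameP.
Qed.

(* The only block with more than one element is [Y]. *)
Definition one_block Y : set_partition n := xchoose (one_block_exists Y).

Lemma same_one_block Y i j : same_block (one_block Y) i j = (i == j) || (i \in Y) && (j \in Y).
Proof. by have /forallP/(_ i)/forallP/(_ j)/eqP := xchooseP (one_block_exists Y). Qed.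

Variable bot : set_partition n.
Hypothesis botP : forall P, refines bot P.

Lemma same_block_bot i j : same_block bot i j = (i == j).
Proof.
apply/idP/eqP => [|->]; last exact: same_block_refl.
have /refinesP h := botP (one_block set0) => /h.
by rewrite same_one_block !inE orbF => /eqP.
Qed.

Lemma neq_botP P : P <> bot -> exists i, exists2 j, i != j & same_block P i j.
Proof.
move=> nP; have [/existsP[i /exists_inP[j neq ij]]|none] :=
  boolP [exists i, exists j in predC1 i, same_block P i j].
  by exists i; exists j; rewrite // eq_sym.
case: nP; apply: same_block_inj => i j; rewrite same_block_bot.
apply/idP/eqP => [ij|->]; last exact: same_block_refl.
apply/eqP; apply: contraNT none => neq; apply/existsP; exists i; apply/exists_inP; exists j => //.
by rewrite inE eq_sym.
Qed.

Lemma one_block_refines Y P :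
  refines (one_block Y) P <-> {in Y &, forall i j, same_block P i j}.
Proof.
split=> [/refinesP h i j iY jY|h]; first by apply: h; rewrite same_one_block iY jY orbT.
apply/refinesP => i j; rewrite same_one_block => /orP[/eqP->|/andP[]]; last exact: h.
exact: same_block_refl.
Qed.

Lemma one_block_neq_bot Y i j : i \in Y -> j \in Y -> i != j -> one_block Y <> bot.
Proof.
move=> iY jY neq eqb; have := same_one_block Y i j.
by rewrite eqb same_block_bot iY jY (negPf neq).
Qed.

Lemma pair_atom i j : i != j -> atom_over (@refines n) bot (one_block [set i; j]).
Proof.
move=> neq; apply/atom_overP; split=> //.
  by apply: (@one_block_neq_bot _ i j); rewrite ?inE ?eqxx ?orbT.
move=> P _ Pij /neq_botP[k [l nkl kl]]; apply: refines_anti => //.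
have /refinesP/(_ k l kl) := Pij; rewrite same_one_block (negPf nkl) /= !inE => kl_ij.
have ij : same_block P i j.
  case/andP: kl_ij => /orP[/eqP ek|/eqP ek] /orP[/eqP el|/eqP el]; subst k l.
  - by rewrite eqxx in nkl.
  - by [].
  - by rewrite same_block_sym.
  by rewrite eqxx in nkl.
apply/one_block_refines => p q /set2P[->|->] /set2P[->|->] //; rewrite ?same_block_refl //.
by rewrite same_block_sym.
Qed.

Lemma atom_pair P : atom_over (@refines n) bot P ->
  exists i, exists2 j, i != j & P = one_block [set i; j].
Proof.
case/atom_overP => _ /neq_botP[i [j neq ij]] atP; exists i; exists j => //.
apply/esym; apply: atP => //.
  apply/one_block_refines => p q /set2P[->|->] /set2P[->|->] //; rewrite ?same_block_refl //.
  by rewrite same_block_sym.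
by apply: (@one_block_neq_bot _ i j); rewrite ?inE ?eqxx ?orbT.
Qed.

Lemma pair_refines i j P : refines (one_block [set i; j]) P = same_block P i j.
Proof.
apply/idP/idP => [/one_block_refines h|ij].
  by apply: h; rewrite !inE eqxx ?orbT.
apply/one_block_refines => p q /set2P[->|->] /set2P[->|->] //; rewrite ?same_block_refl //.
by rewrite same_block_sym.
Qed.

(* A complete graph is not the union of two equivalence relations unless one
   of them is everything. *)
Lemma connected_one_block Y : (1 < #|Y|)%N -> connected_over (@refines n) bot (one_block Y).
Proof.
case/card_gt1P => i0 [j0 [i0Y j0Y neq]]; apply/connected_overP; split=> //.
  exact: one_block_neq_bot neq.
move=> u v _ uY _ vY at_uv.
have uv : {in Y &, forall i j, same_block u i j || same_block v i j}.
  move=> i j iY jY; have [->|nij] := eqVneq i j; first by rewrite same_block_refl.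
  rewrite -!pair_refines; apply: at_uv; first exact: pair_atom.
  apply/one_block_refines => p q /set2P[->|->] /set2P[->|->];
    by rewrite same_one_block ?iY ?jY orbT.
have [/forall_inP all_u|] := boolP [forall i in Y, [forall j in Y, same_block u i j]].
  left; apply: refines_anti => //; apply/one_block_refines => i j iY jY.
  by have /forall_inP/(_ j jY) := all_u i iY.
case/forall_inPn => k kY /forall_inPn[l lY nkl]; right; apply: refines_anti => //.
have vkl : same_block v k l by have := uv k l kY lY; rewrite (negPf nkl).
(* As [u] separates [k] from [l], it cannot join [i] to both; hence [v] joins [i] to [k], directly
   or through [l]. *)
have vk i : i \in Y -> same_block v k i.
  move=> iY; have /orP[uik|//] := uv k i kY iY.
  have /orP[uil|vil] := uv i l iY lY.
    by case/negP: nkl; apply: same_block_trans uik uil.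
  by apply: same_block_trans vkl _; rewrite same_block_sym.
by apply/one_block_refines => i j iY jY; rewrite -(same_block_left (vk i iY)) vk.
Qed.

(** Take a block [Y] of [z] with two elements, and let [v] be [z] with [Y] broken into singletons.
    Every pair joined by [z] is joined by [one_block Y] or by [v], and [v] is not [z]. *)
Lemma connected_is_one_block z : connected_over (@refines n) bot z ->
  exists2 Y : {set 'I_n}, (1 < #|Y|)%N & z = one_block Y.
Proof.
case/connected_overP => _ /neq_botP[i [j nij zij]] conn.
pose Y := pblock (val z) i.
have iY : i \in Y by apply: same_block_refl.
have Y_same k l : k \in Y -> same_block z k l = (l \in Y).
  by move=> kY; rewrite -(same_block_left (kY : same_block z i k)).
pose r : rel 'I_n := fun k l => (k == l) || (k \notin Y) && same_block z k l.
have er : equivalence_rel r.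
  apply/equivalence_relP; split=> [k|k l]; rewrite /r ?eqxx //.
  case/orP => [/eqP-> //|/andP[kY kl] p].
  have lY : l \notin Y.
    by apply: contra kY => lY; rewrite -(Y_same l) // same_block_sym.
  rewrite kY lY /= (same_block_left kl).
  have [<-|_] := eqVneq k p; first by rewrite same_block_sym kl !orbT.
  by have [<-|_] := eqVneq l p; rewrite ?same_block_refl ?orbT.
have [v sv] := set_partition_of er.
have vz : refines v z.
  apply/refinesP => k l; rewrite sv => /orP[/eqP->|/andP[]//]; exact: same_block_refl.
have Yz : refines (one_block Y) z.
  by apply/one_block_refines => k l kY lY; rewrite Y_same.
have [//|//|//|//||defz|vz'] := conn (one_block Y) v.
- move=> a /atom_pair[k [l nkl ->]]; rewrite !pair_refines => zkl.
  have [kY|kY] := boolP (k \in Y).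
    by rewrite same_one_block kY -(Y_same k) ?zkl ?orbT.
  by rewrite sv /r kY zkl !orbT.
- exists Y => //; apply/card_gt1P; exists i; exists j; split=> //.
have := sv i j; rewrite vz' zij /r (negPf nij) iY //.
Qed.

Lemma one_block_inj Y Z : (1 < #|Y|)%N -> (1 < #|Z|)%N -> one_block Y = one_block Z -> Y = Z.
Proof.
have sub (A B : {set 'I_n}) : (1 < #|A|)%N -> one_block A = one_block B -> A \subset B.
  case/card_gt1P => i [j [iA jA nij]] eqAB; apply/subsetP => k kA.
  have [l lA nkl] : exists2 l, l \in A & k != l.
    by have [eqk|nki] := eqVneq k i; [exists j; rewrite // eqk | exists i].
  have := same_one_block A k l; rewrite eqAB same_one_block kA lA orbT (negPf nkl) /=.
  by case/andP.
move=> Y1 Z1 eqYZ; apply/eqP; rewrite eqEsubset !sub //.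
Qed.

(** The maximal connected elements below [P] recover its blocks, except for the singletons, which
    leave no trace in the order. *)
Lemma max_connected_one_block P Y : (1 < #|Y|)%N ->
  max_connected (@refines n) bot P (one_block Y) = (Y \in val P).
Proof.
move=> Y1; have [i iY] : exists i, i \in Y by apply/card_gt0P; apply: ltnW.
apply/and3P/idP => [[_ /one_block_refines YP /forallP mx]|YP]; last first.
  split; first exact: connected_one_block.
    apply/one_block_refines => k l kY lY.
    by rewrite /same_block (set_partition_pblock YP kY).
  apply/forallP => z; apply/implyP => /and3P[/connected_is_one_block[Z Z1 ->]].
  move=> /one_block_refines ZP /one_block_refines YZ; apply/eqP; congr one_block.
  have iZ : i \in Z.
    have [k kY nki] : exists2 k, k \in Y & i != k.
      case/card_gt1P: Y1 => k [l [kY lY nkl]]; have [eqk|nik] := eqVneq i k; last by exists k.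
      by exists l; rewrite // eqk.
    by have := YZ i k iY kY; rewrite same_one_block (negPf nki) => /andP[].
  apply/eqP; rewrite eqEsubset; apply/andP; split; apply/subsetP => k kY.
    by have := ZP i k iZ kY; rewrite /same_block (set_partition_pblock YP iY).
  have := YZ i k iY kY; rewrite same_one_block => /orP[/eqP<-//|/andP[]//].
set Z := pblock (val P) i; have ZP : Z \in val P by apply: pblock_mem; apply: set_partition_cover.
have YZ : Y \subset Z by apply/subsetP => k kY; apply: YP.
have Z1 : (1 < #|Z|)%N by apply: leq_trans Y1 (subset_leq_card YZ).
have /implyP := mx (one_block Z); rewrite connected_one_block //= => h.
suff /eqP : one_block Z == one_block Y by move/one_block_inj => <-.
apply: h; apply/andP; split; apply/one_block_refines => k l.
  by move=> kZ lZ; rewrite /same_block (set_partition_pblock ZP kZ).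
by move=> kY lY; rewrite same_one_block !(subsetP YZ) // orbT.
Qed.

End PartitionLattice.

Section PartitionCounts.
Variables (n : nat) (R : comNzRingType) (B : nat -> R).
Implicit Types (P : set_partition n) (Y Z : {set 'I_n}).

Lemma partition_down_sum P :
  \sum_(P' | refines P' P) \prod_(Y in val P') B #|Y| =
  \prod_(Z in val P) partition_sum B #|Z|.
Proof.
(* Refinement of [P] is encoded by weight 0 for the sets that no block of [P] contains. *)
pose c Y : R := if [exists Z in val P, Y \subset Z] then B #|Y| else 0.
have c_block Z : Z \in val P -> partition_sum B #|Z| = block_sum id c Z.
  move=> ZP; rewrite -block_sum_card; apply: eq_block_sum => Y _ YZ.
  by rewrite /c; case: ifP => // /exists_inP[]; exists Z.
rewrite (eq_bigr _ c_block) -(block_sum_partition (valP P)); last first.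
  move=> Y Z Z' ZP Z'P /pred0Pn[i /= /andP[iY iZ]] /pred0Pn[j /= /andP[jY jZ']] neq.
  rewrite /c; case: ifP => // /exists_inP[Z0 Z0P /subsetP sub].
  case/eqP: neq; rewrite -(set_partition_pblock ZP iZ) (set_partition_pblock Z0P (sub i iY)).
  by rewrite -(set_partition_pblock Z'P jZ') (set_partition_pblock Z0P (sub j jY)).
rewrite /block_sum (bigID (fun W : {set {set 'I_n}} => [forall Y in W, [exists Z in val P, Y \subset Z]])) /=.
rewrite [X in _ = _ + X]big1 ?addr0 => [|W /andP[_ /forall_inPn[Y YW bad]]]; last first.
  by rewrite (big_setD1 Y YW) /= {1}/c (negPf bad) mul0r.
rewrite [RHS](reindex_omap (val : set_partition n -> _) insub) /=; last first.
  by move=> W /andP[]; rewrite block_partition_id => pW _; rewrite insubT.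
apply: eq_big => [P'|P' /forall_inP ref].
  by rewrite block_partition_id (valP P') valK eqxx andbT.
by apply: eq_bigr => Y YP'; rewrite /c ref.
Qed.

End PartitionCounts.

Lemma card_refines n (P : set_partition n) :
  #|[set P' | refines P' P]|%:R =
  \prod_(Z in val P) partition_sum (fun=> 1 : rat) #|Z|.
Proof.
rewrite -partition_down_sum -sum1_card natr_sum.
by apply: eq_big => [P'|P' _]; rewrite ?inE // big1.
Qed.

Definition bell (n : nat) : rat := partition_sum (fun=> 1) n.

Lemma bell_ge1 n : 1 <= bell n.
Proof.
elim/ltn_ind: n => -[//|n] IHn; rewrite /bell partition_sumS big_ord_recl /= bin0 !mul1r subn0.
rewrite -[leLHS]addr0 lerD ?IHn // sumr_ge0 // => i _.
rewrite mulr1 mulr_ge0 // (le_trans ler01) // IHn // ltnS leq_subr //.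
Qed.

(** The recursion for [bell k.+1] contains [bell k] as its first term and, for positive [k], a
    positive last term. At 0 this fails: [bell 0] and [bell 1] are both 1. *)
Lemma bell_lt m n : (0 < m)%N -> (m < n)%N -> bell m < bell n.
Proof.
have bell_ltS k : (0 < k)%N -> bell k < bell k.+1.
  case: k => // k _; rewrite /bell [ltRHS]partition_sumS big_ord_recl /= bin0 !mul1r subn0.
  rewrite ltrDl big_ord_recr /= ltr_wpDl //.
    apply: sumr_ge0 => i _.
    by rewrite mulr1 mulr_ge0 // (le_trans ler01) // bell_ge1.
  by rewrite /bump /= mulr1 mulr_gt0 ?ltr0n ?bin_gt0 // (lt_le_trans ltr01) // bell_ge1.
move=> m0; elim: n => // n IHn; rewrite ltnS leq_eqVlt => /orP[/eqP<-|ltmn].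
  exact: bell_ltS.
by apply: lt_trans (IHn ltmn) (bell_ltS n _); apply: leq_trans ltmn.
Qed.

Lemma bell_inj m n : (0 < m)%N -> (0 < n)%N -> bell m = bell n -> m = n.
Proof.
move=> m0 n0 eqb; case: (ltngtP m n) => // lt_mn.
  by have := bell_lt m0 lt_mn; rewrite eqb ltxx.
by have := bell_lt n0 lt_mn; rewrite eqb ltxx.
Qed.

Lemma one_block_blocks n (Y : {set 'I_n}) : (0 < #|Y|)%N ->
  \prod_(Z in val (one_block Y)) bell #|Z| = bell #|Y|.
Proof.
case/card_gt0P => i iY; have bell1 : bell 1 = 1.
  by rewrite /bell partition_sumS big_ord_recl big_ord0 /= partition_sum0 bin0 !mulr1 addr0.
have YP : Y \in val (one_block Y).
  suff {1}-> : Y = pblock (val (one_block Y)) i.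
    by apply: pblock_mem; apply: set_partition_cover.
  apply/setP => j; rewrite -[RHS]/(same_block (one_block Y) i j) same_one_block iY /=.
  by case: eqP => [<-|//]; rewrite iY.
rewrite (big_setD1 Y YP) /= big1 ?mulr1 // => Z /setD1P[neq ZP].
have /set0Pn[j jZ] := partition_neq0 (valP (one_block Y)) ZP.
suff -> : Z = [set j] by rewrite cards1.
apply/setP => k; rewrite -(set_partition_pblock ZP jZ) inE.
rewrite -[LHS]/(same_block (one_block Y) j k) same_one_block.
case jY : (j \in Y); last by rewrite orbF eq_sym.
by case/eqP: neq; rewrite -(set_partition_pblock ZP jZ) (set_partition_pblock YP jY).
Qed.

Lemma nb_max_connected_partition n (bot P : set_partition n) (b : rat) :
  (forall P, refines bot P) ->
  nb_max_connected (@refines n) bot P b =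
  #|[set Y in val P | (1 < #|Y|)%N && (bell #|Y| == b)]|.
Proof.
move=> botP; rewrite /nb_max_connected -(card_in_imset (f := @one_block n)).
  have card_down (Y : {set 'I_n}) : (1 < #|Y|)%N ->
      #|[set P' | refines bot P' && refines P' (one_block Y)]|%:R = bell #|Y|.
    move=> Y1; rewrite -one_block_blocks ?(ltnW Y1) // -card_refines; congr _%:R.
    by apply: eq_card => P'; rewrite !inE botP.
  apply: eq_card => z; rewrite inE; apply/andP/imsetP => [[mz cz]|[Y + ->]].
    have /and3P[/(connected_is_one_block botP)[Y Y1 def_z] _ _] := mz.
    rewrite def_z max_connected_one_block // card_down // in mz cz.
    by exists Y; rewrite // inE mz Y1.
  by rewrite inE => /and3P[YP Y1 bY]; rewrite max_connected_one_block // card_down.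
move=> Y Z; rewrite !inE => /and3P[_ Y1 _] /and3P[_ Z1 _]; exact: one_block_inj.
Qed.

(** * Counting over minimal elements *)

Section MinimalElements.
Variables (d : Order.disp_t) (T : finPOrderType d).
Implicit Types (m x y : T).

Lemma is_minimalP m : reflect (forall y, (y <= m)%O -> y = m) (is_minimal m).
Proof.
apply: (iffP forallP) => [mm y ym|mm y]; first by have := mm y; rewrite ym => /eqP.
by apply/implyP => /mm ->.
Qed.

Lemma exists_minimal_le x : exists2 m, is_minimal m & (m <= x)%O.
Proof.
have [k] := ubnP #|[set y : T | (y <= x)%O]|; elim: k x => // k IHk x; rewrite ltnS => lek.
have [xm|] := boolP (is_minimal x); first by exists x.
case/forallPn => y; rewrite negb_imply => /andP[yx nyx].
have [|m mm my] := IHk y; last by exists m; last exact: le_trans yx.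
apply: leq_trans lek; apply/proper_card/properP; split.
  by apply/subsetP => z; rewrite !inE => /le_trans; apply.
by exists x; rewrite inE ?lexx //; apply: contra nyx => xy; apply/eqP/le_anti; rewrite yx.
Qed.

Lemma le_unique_maximal top : (forall x, is_maximal x <-> x = top) -> forall x, (x <= top)%O.
Proof.
move=> topP x; have [k] := ubnP #|[set y : T | (x <= y)%O]|.
elim: k x => // k IHk x; rewrite ltnS => lek.
have [/topP->//|] := boolP (is_maximal x).
case/forallPn => y; rewrite negb_imply => /andP[xy nyx].
apply: (le_trans xy); apply: IHk; apply: leq_trans lek; apply/proper_card/properP; split.
  by apply/subsetP => z; rewrite !inE; apply: le_trans.
by exists x; rewrite inE ?lexx //; apply: contra nyx => yx; apply/eqP/le_anti; rewrite xy yx.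
Qed.

Lemma rank_minimal m : is_minimal m -> rank m = 0%N.
Proof.
move/is_minimalP => mm; apply/eqP; rewrite -leqn0; apply/bigmax_leqP => C /andP[_ /forall_inP Cm].
rewrite leqn0 cards_eq0; apply/eqP/setP => y; rewrite inE; apply/negP => yC.
have ltym := Cm y yC; have eqym := mm y (ltW ltym).
by rewrite eqym ltxx in ltym.
Qed.

Definition nb_minimal_le x : nat := #|[set m | is_minimal m && (m <= x)%O]|.

Lemma nb_minimal_le_gt0 x : (0 < nb_minimal_le x)%N.
Proof.
by have [m mm mx] := exists_minimal_le x; apply/card_gt0P; exists m; rewrite inE mm.
Qed.

(** Each [y] below [x] is counted once for every minimal element below it, which the denominator
    compensates. *)
Lemma sum_minimal_le (w : T -> rat) x :
  \sum_(y | (y <= x)%O) w y =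
  \sum_(m | is_minimal m && (m <= x)%O)
    \sum_(y | (m <= y <= x)%O) w y / (nb_minimal_le y)%:R.
Proof.
rewrite (exchange_big_dep (fun y => (y <= x)%O)) /=; last by move=> m y _ /andP[].
apply: eq_bigr => y yx.
rewrite (eq_bigl (mem [set m | is_minimal m && (m <= y)%O])); last first.
  move=> m; rewrite !inE yx andbT -andbA; apply: andb_id2l => _.
  by apply/andP/idP => [[]//|my]; rewrite (le_trans my yx).
rewrite sumr_const -/(nb_minimal_le y) -[RHS]mulr_natr mulfVK //.
by rewrite pnatr_eq0 -lt0n nb_minimal_le_gt0.
Qed.

Lemma sum_interval (L : finType) (leL : rel L) m top
    (f : poset_interval m top -> L) (w : T -> rat) (W : L -> rat) :
  bijective f -> {mono f : y z / poset_interval_le y z >-> leL y z} ->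
  (forall y : poset_interval m top, w (val y) = W (f y)) ->
  forall x : poset_interval m top,
    \sum_(y | (m <= y <= val x)%O) w y = \sum_(u | leL u (f x)) W u.
Proof.
move=> bij_f mono_f eqW x; rewrite (reindex f) /=; last by case: bij_f => g; exists g.
rewrite (reindex_omap (val : poset_interval m top -> T) insub) /=; last first.
  move=> y /andP[my yx]; rewrite insubT //= my (le_trans yx) //.
  by have /andP[] := valP x.
apply: eq_big => [y|y _]; last exact: eqW.
rewrite mono_f valK eqxx andbT /poset_interval_le.
by have /andP[-> _] := valP y.
Qed.

End MinimalElements.

(** A variant for bare relations, since the ideals and products in the axioms are ordered by
    relations. *)
Definition minimal_in (T : finType) (le : rel T) : {set T} :=
  [set x | [forall y, le y x ==> (y == x)]].

Lemma minimal_inP (T : finType) (le : rel T) x :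
  reflect (forall y, le y x -> y = x) (x \in minimal_in le).
Proof.
rewrite inE; apply: (iffP forallP) => [mx y yx|mx y]; first by have := mx y; rewrite yx => /eqP.
by apply/implyP => /mx ->.
Qed.

Lemma card_minimal_iso (S T : finType) (leS : rel S) (leT : rel T) :
  order_iso leS leT -> #|minimal_in leS| = #|minimal_in leT|.
Proof.
case=> f [g fK gK] f_mono; rewrite -(card_imset _ (can_inj fK)); apply: eq_card => t.
apply/imsetP/minimal_inP => [[x /minimal_inP mx ->] t'|mt].
  by rewrite -[t']gK f_mono => /mx ->.
exists (g t); rewrite ?gK //; apply/minimal_inP => y.
by rewrite -f_mono gK => /mt <-; rewrite fK.
Qed.

Lemma card_minimal_ideal (d : Order.disp_t) (T : finPOrderType d) (x : T) :
  #|minimal_in (@ideal_le _ _ x)| = nb_minimal_le x.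
Proof.
rewrite -(card_imset _ val_inj); apply: eq_card => m; rewrite inE.
apply/imsetP/andP => [[u /minimal_inP mu ->]|[/is_minimalP mm mx]].
  split; last exact: (valP u).
  apply/is_minimalP => y yu; have yx : (y <= x)%O := le_trans yu (valP u).
  by have /(congr1 val) := mu (exist _ y yx) yu.
exists (exist _ m mx) => //; apply/minimal_inP => y ym.
by apply: val_inj; apply: mm.
Qed.

Lemma card_minimal_pair (S T : finType) (leS : rel S) (leT : rel T) :
  reflexive leS -> reflexive leT ->
  #|minimal_in (fun u v : S * T => leS u.1 v.1 && leT u.2 v.2)| =
  (#|minimal_in leS| * #|minimal_in leT|)%N.
Proof.
move=> rS rT; rewrite -cardsX; apply: eq_card => -[x y]; rewrite in_setX /=.
apply/minimal_inP/andP => [mxy|[/minimal_inP mx /minimal_inP my] [x' y'] /= /andP[/mx-> /my->]//].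
split; apply/minimal_inP => z zx.
  by have := mxy (z, y); rewrite /= zx rT => /(_ isT)[].
by have := mxy (x, z); rewrite /= zx rS => /(_ isT)[].
Qed.

Lemma card_minimal_prod (d : Order.disp_t) (K : finType) (T : K -> finPOrderType d) :
  #|minimal_in (@prod_le d K T)| = (\prod_p nb_minimal (T p))%N.
Proof.
have -> : #|minimal_in (@prod_le d K T)| =
  #|(family (fun p => [pred x : T p | is_minimal x]) : {pred {dffun forall p, T p}})|.
  apply: eq_card => z; apply/minimal_inP/familyP => [mz p|mz y /prod_leP yz].
    rewrite inE; apply/is_minimalP => t tz.
    suff <- : embed z t = z by rewrite embedE.
    apply: mz; apply/prod_leP => q; have [<-|neq] := eqVneq p q; first by rewrite embedE.
    by rewrite embed_neq.
  apply/ffunP => p; have := mz p; rewrite inE => /is_minimalP; apply; exact: yz.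
rewrite card_family foldrE big_map big_enum /=; apply: eq_bigr => p _.
by apply: eq_card => x; rewrite inE.
Qed.

Lemma prod_sig_const (n : nat) (a : 'I_n -> nat) (F : 'I_n -> nat) :
  (\prod_(p : {i : 'I_n & 'I_(a i)}) F (tag p) = \prod_i F i ^ a i)%N.
Proof.
under [RHS]eq_bigr => i _ do rewrite -[a i]card_ord -prod_nat_const.
by rewrite (sig_big_dep (J := fun i => 'I_(a i)) _ _ (fun i _ => F i)) /=.
Qed.

Lemma sum_sig_const (n : nat) (a : 'I_n -> nat) (F : 'I_n -> nat) :
  (\sum_(p : {i : 'I_n & 'I_(a i)}) F (tag p) = \sum_i a i * F i)%N.
Proof.
under [RHS]eq_bigr => i _ do rewrite -{1}[a i]card_ord -sum_nat_const.
by rewrite (sig_big_dep (J := fun i => 'I_(a i)) _ _ (fun i _ => F i)) /=.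
Qed.

(** Passage from products over blocks to products over types; blocks must be nonempty, as sizes are
    indexed from 1. *)
Lemma prod_by_card (n : nat) (E : finType) (dom : E -> {set 'I_n}) (W : {set E})
    (R : comNzRingType) (B : nat -> R) :
  (forall Y, Y \in W -> dom Y != set0) ->
  \prod_(Y in W) B #|dom Y| =
  \prod_(i < n) B i.+1 ^+ #|[set Y in W | #|dom Y| == i.+1]|.
Proof.
move=> W0; rewrite [RHS](eq_bigr (fun i : 'I_n => \prod_(Y in W) if #|dom Y| == i.+1 then B i.+1 else 1)).
  rewrite exchange_big; apply: eq_bigr => Y /W0; rewrite -card_gt0 => dY.
  have ltn_n : (#|dom Y|.-1 < n)%N by rewrite prednK // -[leqRHS]card_ord max_card.
  rewrite (bigD1 (Ordinal ltn_n)) //= prednK // eqxx big1 ?mulr1 // => i neq.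
  case: eqP => // eqi; case/eqP: neq; apply: val_inj; by rewrite /= eqi.
move=> i _; rewrite -big_mkcondr /= -prodr_const; apply: eq_bigl => Y.
by rewrite inE.
Qed.

(** * Types in an exponential structure *)

Section Exponential.
Variables (d : Order.disp_t) (Q : exp_structure d).
Implicit Types (n : nat).

Lemma expQ_le_top n (x : Q n) : (0 < n)%N -> (x <= expQ_top Q n)%O.
Proof. by move=> n0; apply: le_unique_maximal; apply: expQ_topP. Qed.

Definition partition_map n (m : Q n)
    (f : poset_interval m (expQ_top Q n) -> set_partition n) : Prop :=
  bijective f /\ {mono f : y z / poset_interval_le y z >-> refines y z}.

Lemma expQ_partition_map n (m : Q n) : (0 < n)%N -> is_minimal m ->
  exists f, @partition_map n m f.
Proof.
move=> n0 mm; have := expQ_upper n0 m; rewrite rank_minimal // subn0.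
by case=> f bij_f mono_f; exists f.
Qed.

Section PartitionMap.
Variables (n : nat) (n_gt0 : (0 < n)%N) (m : Q n).
Variable f : poset_interval m (expQ_top Q n) -> set_partition n.
Hypothesis f_map : partition_map f.

Let f_bij : bijective f. Proof. by case: f_map. Qed.
Let f_mono : {mono f : y z / poset_interval_le y z >-> refines y z}.
Proof. by case: f_map. Qed.

Lemma interval_bot_proof : (m <= m <= expQ_top Q n)%O.
Proof. by rewrite lexx expQ_le_top. Qed.
Definition interval_bot : poset_interval m (expQ_top Q n) := exist _ m interval_bot_proof.

Lemma interval_top_proof : (m <= expQ_top Q n <= expQ_top Q n)%O.
Proof. by rewrite lexx expQ_le_top. Qed.
Definition interval_top : poset_interval m (expQ_top Q n) := exist _ (expQ_top Q n) interval_top_proof.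

Lemma partition_map_bot P : refines (f interval_bot) P.
Proof.
case: f_bij => g fK gK; rewrite -(gK P) f_mono.
by have /andP[] := valP (g P).
Qed.

Lemma partition_map_top P : refines P (f interval_top).
Proof.
case: f_bij => g fK gK; rewrite -(gK P) f_mono.
by have /andP[] := valP (g P).
Qed.

Lemma blocks_top Y : (Y \in val (f interval_top)) = (Y == [set: 'I_n]).
Proof.
have block_top i : pblock (val (f interval_top)) i = [set: 'I_n].
  apply/setP => j; rewrite [RHS]inE -[LHS]/(same_block _ i j).
  have /refinesP := partition_map_top (one_block [set: 'I_n]); apply.
  by rewrite same_one_block !inE orbT.
apply/idP/eqP => [YP|->]; last first.
  have := pblock_mem (set_partition_cover (f interval_top) (Ordinal n_gt0)).
  by rewrite block_top.
have /set0Pn[i iY] := partition_neq0 (valP (f interval_top)) YP.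
by rewrite -(set_partition_pblock YP iY).
Qed.

Lemma nb_max_connected_interval (y : poset_interval m (expQ_top Q n)) b :
  nb_max_connected (<=%O : rel (Q n)) m (val y) b =
  #|[set Y in val (f y) | (1 < #|Y|)%N && (bell #|Y| == b)]|.
Proof.
rewrite -(nb_max_connected_partition _ _ partition_map_bot).
have f_inj := bij_inj f_bij.
rewrite (nb_max_connected_image f_inj f_mono (@refines_trans n)); last first.
  by case: f_bij => g fK gK t _ _; exists (g t); rewrite gK.
rewrite -[m in LHS]/(val interval_bot).
apply: (nb_max_connected_image val_inj (leS := @poset_interval_le _ _ m (expQ_top Q n))) => //.
  exact: le_trans.
move=> t mt tx; have ok : (m <= t <= expQ_top Q n)%O by rewrite mt expQ_le_top.
by exists (exist _ t ok).
Qed.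

End PartitionMap.

(** The top corresponds to the partition with one block, so [Q n] is indecomposable over [m], with
    [bell n] elements above [m]. For [n = 1] it is a point and contributes nothing. *)
Lemma nb_max_connected_expQ n (m : Q n) b : (0 < n)%N -> is_minimal m ->
  nb_max_connected (<=%O : rel (Q n)) m (expQ_top Q n) b = ((1 < n)%N && (bell n == b)).
Proof.
move=> n0 mm; have [f f_map] := expQ_partition_map n0 mm.
have := nb_max_connected_interval n0 f_map (interval_top n0 m) b => /= ->.
case: (boolP ((1 < n)%N && (bell n == b))) => cond.
  transitivity #|[set [set: 'I_n]]|; last by rewrite cards1.
  apply: eq_card => Y; rewrite !inE blocks_top //.
  by case: eqP => [->|//]; rewrite cardsT card_ord cond.
apply/eqP; rewrite -[X in _ == X]/0%N cards_eq0 -subset0; apply/subsetP => Y.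
by rewrite !inE blocks_top // => /andP[/eqP->]; rewrite cardsT card_ord (negPf cond).
Qed.

(** In the product isomorphic to the ideal of [x], the elements [x] and [m] have tops and minimal
    elements as coordinates. Each factor [Q_(i+1)] with [i > 0] thus yields one maximal connected
    element, of interval size [bell i.+1], and injectivity of [bell] selects [i = j]. *)
Lemma expQ_type_nb n (x m : Q n) (j : 'I_n) : (0 < n)%N -> is_minimal m -> (m <= x)%O ->
  (0 < j)%N ->
  expQ_type x j = nb_max_connected (<=%O : rel (Q n)) m x (bell j.+1).
Proof.
move=> n0 mm mx j0; have [g [g' gK g'K] g_mono] := expQ_ideal n0 x.
pose m' : ideal x := exist _ m mx; pose x' : ideal x := exist _ x (lexx x).
have -> : nb_max_connected (<=%O : rel (Q n)) m x (bell j.+1) =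
          nb_max_connected (@ideal_le _ _ x) m' x' (bell j.+1).
  rewrite -[m in LHS]/(val m') -[x in LHS]/(val x').
  apply: (nb_max_connected_image val_inj (leS := @ideal_le _ _ x)) => //.
    exact: le_trans.
  by move=> t _ tx; exists (exist _ t tx).
rewrite -(nb_max_connected_image (can_inj gK) g_mono (@prod_le_trans _ _ _)); last first.
  by move=> t _ _; exists (g' t); rewrite g'K.
have le_gmx : prod_le (g m') (g x') by rewrite [prod_le _ _]g_mono.
rewrite [RHS](nb_max_connected_prod le_gmx).
have gx_top p : g x' p = expQ_top Q (tag p).+1.
  pose t : power_prod Q (expQ_type x) := 
    finfun (fun p : {i : 'I_n & 'I_(expQ_type x i)} => expQ_top Q (tag p).+1).
  have : power_prod_le t (g x').
    by rewrite -[t]g'K g_mono; apply: (valP (g' t)).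
  move=> /forallP/(_ p); rewrite ffunE => le1; apply/le_anti.
  by rewrite le1 expQ_le_top.
have gm_min p : is_minimal (g m' p).
  apply/is_minimalP => t tm; suff <- : embed (g m') t = g m' by rewrite embedE.
  have le_t : power_prod_le (embed (g m') t) (g m').
    apply/forallP => q; have [<-|neq] := eqVneq p q; first by rewrite embedE.
    by rewrite embed_neq.
  move: le_t; rewrite -[embed _ _]g'K g_mono => le_t; congr g.
  apply: val_inj; exact: (is_minimalP _ mm).
under eq_bigr => p _ do rewrite gx_top nb_max_connected_expQ //.
rewrite (sum_sig_const _ (fun i : 'I_n => (1 < i.+1)%N && (bell i.+1 == bell j.+1) : nat)).
rewrite (bigD1 j) //= eqxx ltnS j0 muln1 big1 ?addn0 // => i neq.
case: eqP => [eqb|_]; last by rewrite andbF muln0.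
by case/eqP: neq; apply: val_inj; case: (bell_inj (ltn0Sn i) (ltn0Sn j) eqb).
Qed.

(** For sizes above 1, both sides count the same maximal connected elements, seen in the lower ideal
    and in the upper interval. *)
Lemma expQ_type_blocks n (m : Q n) f (y : poset_interval m (expQ_top Q n)) (j : 'I_n) :
  (0 < n)%N -> is_minimal m -> partition_map f ->
  expQ_type (val y) j = #|[set Y in val (f y) | #|Y| == j.+1]|.
Proof.
move=> n0 mm f_map; have my : (m <= val y)%O by have /andP[] := valP y.
have type_pos (i : 'I_n) : (0 < i)%N ->
    expQ_type (val y) i = #|[set Y in val (f y) | #|Y| == i.+1]|.
  move=> i0; rewrite (expQ_type_nb n0 mm my i0) (nb_max_connected_interval n0 f_map).
  apply: eq_card => Y; rewrite !inE; apply: andb_id2l => YP.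
  apply/andP/eqP => [[Y1 /eqP/bell_inj ->//]|->]; first exact: ltnW.
  by rewrite eqxx ltnS.
have [|j0] := posnP j; last exact: type_pos.
(* The number of singletons is determined by the total weight. *)
move=> j0.
have sum_f : (\sum_(i < n) i.+1 * #|[set Y in val (f y) | #|Y| == i.+1]| = n)%N.
  transitivity (\sum_(Y in val (f y)) #|Y|)%N.
    rewrite (eq_bigr (fun i : 'I_n => \sum_Y
      if Y \in [set Y in val (f y) | #|Y| == i.+1] then i.+1 else 0)%N) => [|i _]; last first.
      by rewrite -big_mkcond sum_nat_const mulnC.
    rewrite exchange_big [RHS]big_mkcond /=; apply: eq_bigr => Y _.
    case: ifP => [YP|YP]; last by apply: big1 => i _; rewrite inE YP.
    have Y0 : (0 < #|Y|)%N by rewrite card_gt0 (partition_neq0 (valP (f y)) YP).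
    have ltn_n : (#|Y|.-1 < n)%N by rewrite prednK // -[leqRHS]card_ord max_card.
    rewrite (bigD1 (Ordinal ltn_n)) //= inE YP prednK // eqxx big1 ?addn0 // => i neq.
    rewrite inE YP; case: eqP => // eqi; case/eqP: neq; apply: val_inj; by rewrite /= eqi.
  by rewrite -(card_partition (valP (f y))) cardsT card_ord.
have := etrans (expQ_type_weight n0 (val y)) (esym sum_f).
rewrite (bigD1 j) //= [in RHS](bigD1 j) //= j0 !mul1n.
rewrite (eq_bigr (fun i : 'I_n => i.+1 * #|[set Y in val (f y) | #|Y| == i.+1]|)%N).
  by move/eqP; rewrite eqn_add2r => /eqP.
move=> i neq; rewrite type_pos // lt0n; apply: contra neq => /eqP i0.
by apply/eqP/val_inj; rewrite /= i0 j0.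
Qed.

Lemma expQ_nb_minimal_le n (x : Q n) : (0 < n)%N ->
  nb_minimal_le x = (\prod_(i < n) expQ_M Q i.+1 ^ expQ_type x i)%N.
Proof.
move=> n0; rewrite -card_minimal_ideal (card_minimal_iso (expQ_ideal n0 x)).
rewrite -[RHS](prod_sig_const (expQ_type x) (fun i : 'I_n => nb_minimal (Q i.+1))).
exact: card_minimal_prod.
Qed.

Lemma expQ_type_top n (i : 'I_n) : expQ_type (expQ_top Q n) i = (i.+1 == n).
Proof.
have n0 : (0 < n)%N by apply: leq_ltn_trans (ltn_ord i).
have [m mm _] := exists_minimal_le (expQ_top Q n).
have [f f_map] := expQ_partition_map n0 mm.
have := expQ_type_blocks (interval_top n0 m) i n0 mm f_map => /= ->.
case: eqP => [eqi|neq].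
  transitivity #|[set [set: 'I_n]]|; last by rewrite cards1.
  apply: eq_card => Y; rewrite !inE blocks_top //.
  by case: eqP => [->|//]; rewrite cardsT card_ord eqi eqxx.
apply/eqP; rewrite -[X in _ == X]/0%N cards_eq0 -subset0; apply/subsetP => Y.
rewrite !inE blocks_top // => /andP[/eqP->]; rewrite cardsT card_ord => /eqP eqi.
by case: neq.
Qed.

(** This makes the induction on [n] work: below the top only weights of smaller index enter. *)
Lemma expQ_type_lt n (x : Q n) (i : 'I_n) :
  x != expQ_top Q n -> (0 < expQ_type x i)%N -> (i.+1 < n)%N.
Proof.
move=> xNtop; have n0 : (0 < n)%N by apply: leq_ltn_trans (ltn_ord i).
have [m mm mx] := exists_minimal_le x.
have [f f_map] := expQ_partition_map n0 mm.
have ok : (m <= x <= expQ_top Q n)%O by rewrite mx expQ_le_top.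
have := expQ_type_blocks (exist _ x ok) i n0 mm f_map => /= ->.
case/card_gt0P => Y; rewrite inE => /andP[YP /eqP cardY].
rewrite ltn_neqAle ltn_ord andbT; apply: contra xNtop => /eqP eqi.
have YT : Y = [set: 'I_n].
  by apply/eqP; rewrite eqEcard subsetT cardsT card_ord cardY eqi leqnn.
have [f_bij f_mono] := f_map.
have : poset_interval_le (interval_top n0 m) (exist _ x ok).
  rewrite -f_mono; apply/refinesP => k l _.
  have inY p : p \in Y by rewrite YT inE.
  by rewrite /same_block (set_partition_pblock YP (inY k)) inY.
move=> le_top; apply/eqP/le_anti; rewrite expQ_le_top //=; exact: le_top.
Qed.

End Exponential.

(** * Restricted structures *)

Lemma nb_minimal_gt0 (d : Order.disp_t) (T : finPOrderType d) (x : T) : (0 < nb_minimal T)%N.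
Proof. by have [m mm _] := exists_minimal_le x; apply/card_gt0P; exists m; rewrite inE. Qed.

Section RestrictedExponential.
Variables (d : Order.disp_t) (Q : exp_structure d) (I : {pred nat}).

Lemma expQ_M_neq0 n : (expQ_M Q n)%:R != 0 :> rat.
Proof. by case: n => [|n]; rewrite pnatr_eq0 // -lt0n /= (nb_minimal_gt0 (expQ_top Q n.+1)). Qed.

(** The default 0 outside [I] makes the product over a type vanish off the restricted poset, so sums
    may run over all of [Q n]. *)
Definition top_weightQ n : rat :=
  if n \in I then - (mu_bot (restrQ Q I n) (expQ_top Q n))%:~R else 0.

Definition block_weight n : rat := top_weightQ n / (expQ_M Q n)%:R.

Definition type_weight n (a : {ffun 'I_n -> nat}) : rat := \prod_(i < n) top_weightQ i.+1 ^+ a i.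

Lemma type_weight_div n (a : {ffun 'I_n -> nat}) :
  type_weight a / (\prod_(i < n) expQ_M Q i.+1 ^ a i)%N%:R = \prod_(i < n) block_weight i.+1 ^+ a i.
Proof.
rewrite natr_prod -prodf_div; apply: eq_bigr => i _.
by rewrite natrX -expr_div_n.
Qed.

Lemma type_weight_out n (a : {ffun 'I_n -> nat}) : ~~ parts_in I a -> type_weight a = 0.
Proof.
case/forallPn => i; rewrite negb_imply => /andP[ai iI].
by rewrite /type_weight (bigD1 i) //= /top_weightQ (negPf iI) expr0n eqn0Ngt ai mul0r.
Qed.

Local Notation sigma := (partition_sum block_weight).

(** Each minimal element below [x] contributes the same product of the [sigma], by
    [partition_down_sum]; the powers of [M] count these minimal elements. *)
Lemma type_weight_down n (x : Q n) : (0 < n)%N ->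
  \sum_(y | (y <= x)%O) type_weight (expQ_type y) =
  \prod_(i < n) ((expQ_M Q i.+1)%:R * sigma i.+1) ^+ expQ_type x i.
Proof.
move=> n0; rewrite sum_minimal_le.
rewrite (eq_bigr (fun=> \prod_(i < n) sigma i.+1 ^+ expQ_type x i)) => [|m /andP[mm mx]].
  have -> : \sum_(m | is_minimal m && (m <= x)%O) \prod_(i < n) sigma i.+1 ^+ expQ_type x i =
      (nb_minimal_le x)%:R * \prod_(i < n) sigma i.+1 ^+ expQ_type x i.
    by rewrite mulr_natl -sumr_const; apply: eq_bigl => m; rewrite inE.
  rewrite expQ_nb_minimal_le // natr_prod -big_split /=; apply: eq_bigr => i _.
  by rewrite natrX exprMn.
have [f f_map] := expQ_partition_map n0 mm; have [f_bij f_mono] := f_map.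
have types y j := expQ_type_blocks y j n0 mm f_map.
have ok : (m <= x <= expQ_top Q n)%O by rewrite mx expQ_le_top.
have prod_types (B : nat -> rat) (y : poset_interval m (expQ_top Q n)) :
    \prod_(i < n) B i.+1 ^+ expQ_type (val y) i = \prod_(Y in val (f y)) B #|Y|.
  rewrite (prod_by_card (dom := id)) => [|Y]; last exact: partition_neq0 (valP (f y)).
  by apply: eq_bigr => i _; rewrite types.
have := sum_interval (w := fun y : Q n => type_weight (expQ_type y) / (nb_minimal_le y)%:R)
  (W := fun P : set_partition n => \prod_(Y in val P) block_weight #|Y|) f_bij f_mono.
move=> /(_ _ (exist _ x ok)) /= ->; last first.
  by move=> y; rewrite expQ_nb_minimal_le // type_weight_div prod_types.
by rewrite partition_down_sum -(prod_types _ (exist _ x ok)).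
Qed.

Lemma restrQ_weight n (x : Q n) : x \notin restrQ Q I n -> type_weight (expQ_type x) = 0.
Proof. by rewrite inE; apply: type_weight_out. Qed.

Lemma parts_in_gt0 n (a : {ffun 'I_n -> nat}) i : parts_in I a -> (0 < a i)%N -> i.+1 \in I.
Proof. by move/forallP/(_ i)/implyP; apply. Qed.

Lemma prod_type_top (B : nat -> rat) n : (0 < n)%N ->
  \prod_(i < n) B i.+1 ^+ expQ_type (expQ_top Q n) i = B n.
Proof.
move=> n0; have ltn : (n.-1 < n)%N by rewrite prednK.
rewrite (bigD1 (Ordinal ltn)) //= expQ_type_top prednK // eqxx expr1.
rewrite big1 ?mulr1 // => i neq; rewrite expQ_type_top.
case: eqP => // eqi; case/eqP: neq; apply: val_inj; exact: (congr1 predn eqi).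
Qed.

Lemma sum_down_restrict n (x : Q n) :
  \sum_(y in restrQ Q I n | (y <= x)%O) type_weight (expQ_type y) =
  \sum_(y | (y <= x)%O) type_weight (expQ_type y).
Proof.
rewrite [RHS](bigID (mem (restrQ Q I n))) /= [X in _ + X]big1 ?addr0.
  by apply: eq_bigl => y; rewrite andbC.
by move=> y /andP[_ /restrQ_weight].
Qed.

(** The two claims feed each other. The first one at smaller indices gives down-set sums 1 below the
    top of [Q n], hence the second one at [n]; then the total weight is 1 when the top is kept, by
    [one_plus_mu_sum0], which is the first one at [n]. *)
Lemma block_weight_inv n : (0 < n)%N ->
  (n \in I -> (expQ_M Q n)%:R * sigma n = 1) /\
  (forall x, x \in restrQ Q I n -> type_weight (expQ_type x) = - (mu_bot (restrQ Q I n) x)%:~R).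
Proof.
elim/ltn_ind: n => n IHn n0.
have prod1 (x : Q n) : x \in restrQ Q I n -> x != expQ_top Q n ->
    \prod_(i < n) ((expQ_M Q i.+1)%:R * sigma i.+1) ^+ expQ_type x i = 1.
  rewrite inE => xI xNtop; apply: big1 => i _.
  have [->|ai] := posnP (expQ_type x i); first by rewrite expr0.
  have [-> //] := IHn i.+1 (expQ_type_lt xNtop ai) (ltn0Sn i); first by rewrite expr1n.
  exact: parts_in_gt0 ai.
have muE : forall x, x \in restrQ Q I n ->
    type_weight (expQ_type x) = - (mu_bot (restrQ Q I n) x)%:~R.
  apply: (@mu_bot_unique _ _ _ _ (expQ_top Q n)) => [x|x xA xNtop|topA].
  - exact: expQ_le_top.
  - by rewrite sum_down_restrict type_weight_down // prod1.
  rewrite /type_weight prod_type_top // /top_weightQ ifT //.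
  move: topA; rewrite inE => topA; have ltn : (n.-1 < n)%N by rewrite prednK.
  have := parts_in_gt0 (i := Ordinal ltn) topA; rewrite expQ_type_top /= prednK // eqxx.
  exact.
split=> // nI; have topA : expQ_top Q n \in restrQ Q I n.
  rewrite inE; apply/forallP => i; apply/implyP; rewrite expQ_type_top.
  by case: eqP => // ->.
rewrite -(prod_type_top (fun i => (expQ_M Q i)%:R * sigma i)) // -type_weight_down //.
have -> : \sum_(y | (y <= expQ_top Q n)%O) type_weight (expQ_type y) =
    \sum_(y : Q n) type_weight (expQ_type y).
  by apply: eq_bigl => y; rewrite expQ_le_top.
rewrite (one_plus_mu_sumE muE) => [|y /restrQ_weight//].
rewrite (one_plus_mu_sum0 (top := expQ_top Q n)) ?subr0 // => y; exact: expQ_le_top.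
Qed.

Lemma m_restr_sum n : (0 < n)%N ->
  1 - (m_restr Q I n)%:~R = (expQ_M Q n)%:R * sigma n.
Proof.
move=> n0; have [_ muE] := block_weight_inv n0.
rewrite -(one_plus_mu_sumE muE) => [|y /restrQ_weight//].
rewrite -(prod_type_top (fun i => (expQ_M Q i)%:R * sigma i)) // -type_weight_down //.
by apply: eq_bigl => y; rewrite expQ_le_top.
Qed.

End RestrictedExponential.

Section RestrictedDowling.
Variables (gT : finGroupType) (d d' : Order.disp_t) (Q : exp_structure d).
Variables (R : exp_dowling_structure gT d' Q) (I J : {pred nat}).
Local Notation s := #|[set: gT]|.
Local Notation sigma := (partition_sum (block_weight Q I)).

Lemma expR_le_top n (x : R n) : (x <= expR_top R n)%O.
Proof. by apply: le_unique_maximal; apply: expR_topP. Qed.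

Lemma expR_N_neq0 n : (expR_N R n)%:R != 0 :> rat.
Proof. by rewrite pnatr_eq0 -lt0n (nb_minimal_gt0 (expR_top R n)). Qed.

Definition top_weightR n : rat := - (mu_restr R I J n)%:~R.

Definition zero_weight n : rat := top_weightR n / (expR_N R n)%:R.

Definition weightR n (x : R n) : rat :=
  top_weightR (expR_type x).1 * type_weight Q I (expR_type x).2.

Definition enriched_weight n : rat := s%:R ^+ n.-1 * block_weight Q I n.

Definition dowling_sum n : rat :=
  \sum_(k < n.+1) 'C(n, k)%:R * (zero_weight k * partition_sum enriched_weight (n - k)).

Lemma expR_nb_minimal_le n (x : R n) :
  nb_minimal_le x =
  (expR_N R (expR_type x).1 * \prod_(i < n) expQ_M Q i.+1 ^ (expR_type x).2 i)%N.
Proof.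
rewrite -card_minimal_ideal (card_minimal_iso (expR_ideal x)).
rewrite (card_minimal_pair (leS := <=%O) (leT := @power_prod_le _ Q _ _)).
- congr (_ * _)%N.
  rewrite -[RHS](prod_sig_const (expR_type x).2 (fun i : 'I_n => nb_minimal (Q i.+1))).
  exact: card_minimal_prod.
- exact: lexx.
- by move=> u; apply/forallP => p; apply: lexx.
Qed.

Lemma weightR_down n (x : R n) :
  \sum_(y | (y <= x)%O) weightR y =
  (expR_N R (expR_type x).1)%:R * dowling_sum (expR_type x).1 *
  \prod_(i < n) ((expQ_M Q i.+1)%:R * sigma i.+1) ^+ (expR_type x).2 i.
Proof.
rewrite sum_minimal_le; set D := dowling_sum _.
rewrite (eq_bigr (fun=> D * \prod_(i < n) sigma i.+1 ^+ (expR_type x).2 i)) => [|m /andP[mm mx]].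
  have -> : \sum_(m | is_minimal m && (m <= x)%O)
       D * \prod_(i < n) sigma i.+1 ^+ (expR_type x).2 i =
      (nb_minimal_le x)%:R * (D * \prod_(i < n) sigma i.+1 ^+ (expR_type x).2 i).
    by rewrite mulr_natl -sumr_const; apply: eq_bigl => m; rewrite inE.
  rewrite expR_nb_minimal_le natrM -!mulrA; congr (_ * _); rewrite mulrCA; congr (_ * _).
  rewrite natr_prod -big_split /=; apply: eq_bigr => i _.
  by rewrite natrX exprMn.
have [f [f_bij f_mono types]] := expR_type_compat mm.
have ok : (m <= x <= expR_top R n)%O by rewrite mx expR_le_top.
have prod_types (B : nat -> rat) (y : poset_interval m (expR_top R n)) :
    \prod_(i < n) B i.+1 ^+ (expR_type (val y)).2 i =
    \prod_(E in blocks (f y)) B #|underlying E|.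
  rewrite prod_by_card => [|E]; last exact: dowling_block_neq0.
  by apply: eq_bigr => i _; rewrite -types ffunE.
have zero_types (y : poset_interval m (expR_top R n)) : (expR_type (val y)).1 = #|zero_block (f y)| by rewrite -types.
have := sum_interval (w := fun y : R n => weightR y / (nb_minimal_le y)%:R)
  (W := fun w : dowling gT n => zero_weight #|zero_block w| *
                 \prod_(E in blocks w) block_weight Q I #|underlying E|) f_bij f_mono.
move=> /(_ _ (exist _ x ok)) /= ->; last first.
  move=> y; rewrite expR_nb_minimal_le natrM -mulf_div type_weight_div prod_types.
  by rewrite zero_types.
rewrite dowling_down_sum -(prod_types _ (exist _ x ok)).
by rewrite -(zero_types (exist _ x ok)).
Qed.

Lemma expR_type_top n :
  (expR_type (expR_top R n)).1 = n /\ forall i, (expR_type (expR_top R n)).2 i = 0%N.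
Proof.
have [m mm mx] := exists_minimal_le (expR_top R n).
have [f [[g fK gK] f_mono types]] := expR_type_compat mm.
have ok : (m <= expR_top R n <= expR_top R n)%O by rewrite mx lexx.
pose top' : poset_interval m (expR_top R n) := exist _ (expR_top R n) ok.
(* The element without blocks, whose zero block is everything, is the maximum of the Dowling
   lattice; the top of [R n] must have its type. *)
have okw : is_dowling_elt (set0 : {set {set pfun gT n}}, [set: 'I_n]).
  rewrite is_dowling_eltE /= setCT block_partition0 eqxx andbT.
  by apply/forall_inP => E; rewrite inE.
pose w0 : dowling gT n := exist _ (set0 : {set {set pfun gT n}}, [set: 'I_n]) okw.
have zero_top : zero_block (f top') = [set: 'I_n].
  have : dowling_le w0 (f top') by rewrite -[w0]gK f_mono; have /andP[] := valP (g w0).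
  by rewrite dowling_leE => /andP[+ _]; rewrite subTset => /eqP.
have blocks_top E : E \notin blocks (f top').
  apply/negP => Ef; have /set0Pn[i iE] := dowling_block_neq0 Ef.
  by have := dowling_block_zero Ef iE; rewrite zero_top inE.
have := types top' => /= <-; split=> [|i] /=; first by rewrite zero_top cardsT card_ord.
rewrite ffunE; apply/eqP; rewrite cards_eq0 -subset0; apply/subsetP => E.
by rewrite !inE (negPf (blocks_top E)).
Qed.

Lemma expR_type_lt n (x : R n) : x != expR_top R n -> ((expR_type x).1 < n)%N.
Proof.
move=> xNtop; have [m mm mx] := exists_minimal_le x.
have [f [f_bij f_mono types]] := expR_type_compat mm.
have okx : (m <= x <= expR_top R n)%O by rewrite mx expR_le_top.
have okt : (m <= expR_top R n <= expR_top R n)%O by rewrite expR_le_top lexx.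
have := types (exist _ x okx) => /= <- /=.
rewrite ltn_neqAle -[X in (_ <= X)%N]card_ord max_card andbT.
apply: contra xNtop => /eqP cardZ.
have ZT : zero_block (f (exist _ x okx)) = [set: 'I_n].
  by apply/eqP; rewrite eqEcard subsetT cardsT card_ord cardZ leqnn.
have : poset_interval_le (exist _ (expR_top R n) okt : poset_interval m (expR_top R n)) (exist _ x okx).
  rewrite -f_mono dowling_leE /dowling_le_blocks ZT subsetT; apply/forall_inP => E _.
  by rewrite /below_block ZT subsetT.
by move=> le_top; apply/eqP/le_anti; rewrite expR_le_top //=; exact: le_top.
Qed.

Lemma restrR_weight n (x : R n) : x \notin restrR R I J n -> weightR x = 0.
Proof.
rewrite inE negb_and /weightR => /orP[nJ|/type_weight_out->]; last by rewrite mulr0.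
by rewrite /top_weightR /mu_restr (negPf nJ) oppr0 mul0r.
Qed.

Lemma weightR_top n : weightR (expR_top R n) = top_weightR n.
Proof.
rewrite /weightR; have [-> type0] := expR_type_top n.
by rewrite /type_weight big1 ?mulr1 // => i _; rewrite type0.
Qed.

Lemma weightR_down_top n :
  \sum_(y : R n) weightR y = (expR_N R n)%:R * dowling_sum n.
Proof.
rewrite -[LHS](eq_bigl _ _ (fun y => expR_le_top y)) weightR_down.
have [-> type0] := expR_type_top n.
by rewrite big1 ?mulr1 // => i _; rewrite type0.
Qed.

(** The same induction as for [Q], on the size of the zero block; the factors from [Q] already equal
    1 by [block_weight_inv]. *)
Lemma zero_weight_inv n :
  (n \in J -> (expR_N R n)%:R * dowling_sum n = 1) /\
  (forall x, x \in restrR R I J n -> weightR x = - (mu_bot (restrR R I J n) x)%:~R).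
Proof.
elim/ltn_ind: n => n IHn.
have muE : forall x, x \in restrR R I J n -> weightR x = - (mu_bot (restrR R I J n) x)%:~R.
  apply: (@mu_bot_unique _ _ _ _ (expR_top R n)) => [x|x xA xNtop|topA].
  - exact: expR_le_top.
  - transitivity (\sum_(y | (y <= x)%O) weightR y).
      rewrite [RHS](bigID (mem (restrR R I J n))) /= [X in _ + X]big1 ?addr0.
        by apply: eq_bigl => y; rewrite andbC.
      by move=> y /andP[_ /restrR_weight].
    move: xA; rewrite inE => /andP[xJ xI].
    rewrite weightR_down; have [-> // _] := IHn _ (expR_type_lt xNtop).
    rewrite mul1r big1 // => i _; have [->|ai] := posnP ((expR_type x).2 i); first by rewrite expr0.
    by have [-> //] := block_weight_inv Q I (ltn0Sn i); rewrite ?expr1n // (parts_in_gt0 xI ai).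
  rewrite weightR_top /top_weightR /mu_restr ifT //.
  by move: topA; rewrite inE; have [-> _] := expR_type_top n => /andP[].
split=> // nJ; have topA : expR_top R n \in restrR R I J n.
  rewrite inE; have [-> type0] := expR_type_top n; rewrite nJ.
  by apply/forallP => i; rewrite type0.
rewrite -weightR_down_top (one_plus_mu_sumE muE) => [|y /restrR_weight//].
rewrite (one_plus_mu_sum0 (top := expR_top R n)) ?subr0 // => y; exact: expR_le_top.
Qed.

Lemma p_restr_sum n :
  1 - (p_restr R I J n)%:~R = (expR_N R n)%:R * dowling_sum n.
Proof.
have [_ muE] := zero_weight_inv n.
by rewrite -(one_plus_mu_sumE muE) => [|y /restrR_weight//]; apply: weightR_down_top.
Qed.

End RestrictedDowling.

(** * Generating functions *)

Lemma fact_neq0 n : n`!%:R != 0 :> rat.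
Proof. by rewrite pnatr_eq0 -lt0n fact_gt0. Qed.

Lemma binomial_conv (F H : nat -> rat) n :
  (\sum_(k < n.+1) 'C(n, k)%:R * (F k * H (n - k)%N)) / n`!%:R =
  fps_mul (fun k => F k / k`!%:R) (fun k => H k / k`!%:R) n.
Proof.
rewrite mulr_suml; apply: eq_bigr => k _.
have lekn : (k <= n)%N by rewrite -ltnS.
rewrite -(bin_fact lekn) !natrM.
have C0 : 'C(n, k)%:R != 0 :> rat by rewrite pnatr_eq0 -lt0n bin_gt0.
by field; rewrite C0 !fact_neq0.
Qed.

(** The exponential formula in the form [S' = B' S], where [B] and [S] are the exponential
    generating functions of [b] and of its partition sums. *)
Lemma partition_sum_ode (b : nat -> rat) n :
  n.+1%:R * (partition_sum b n.+1 / n.+1`!%:R) =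
  fps_mul (fun k => b k.+1 / k`!%:R) (fun k => partition_sum b k / k`!%:R) n.
Proof.
rewrite -(binomial_conv (fun k => b k.+1)) partition_sumS factS natrM.
under eq_bigr => i _ do rewrite -mulrA.
have n0 : n.+1%:R != 0 :> rat by rewrite pnatr_eq0.
by rewrite invfM mulrCA mulVKf.
Qed.

Theorem theorem4p2 (gT : finGroupType) (s : nat) (s_def : s = #|[set: gT]|)
    (d d' : Order.disp_t) (Q : exp_structure d)
    (R : exp_dowling_structure gT d' Q) (I J : {pred nat})
    (I_pos : forall i : nat, i \in I -> (0 < i)%N) :
  let M := expQ_M Q in
  let N := expR_N R in
  let m := m_restr Q I in
  let p := p_restr R I J in
  let mu := mu_restr R I J in
  (fun b : nat =>
     if b \in J then (mu b)%:~R / (N b * b`!)%N%:R else 0 : rat)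
  =1
  fps_div
    (fun n : nat =>
       - (1 / (N n * n`!)%N%:R)
       + (if n \notin J then (p n)%:~R / (N n * n`!)%N%:R else 0))
    (fps_pow
       (fun n : nat =>
          s%:R ^+ n / (M n * n`!)%N%:R
          - (if (0 < n)%N && (n \notin I)
             then (m n)%:~R * s%:R ^+ n / (M n * n`!)%N%:R else 0))
       (s%:R)^-1).
Proof.
move=> M N m p mu.
have s_neq0 : s%:R != 0 :> rat.
  by rewrite s_def pnatr_eq0 -lt0n cardsT; apply/card_gt0P; exists 1%g.
set numer := fun n : nat => _ + _; set C := fun n : nat => s%:R ^+ n / _ - _.
(* Outside [I] the correction turns 1 into [1 - m n], which is [M n] times the partition sum; inside
   [I] that product is 1. *)
have defC n : C n = s%:R ^+ n * (partition_sum (block_weight Q I) n / n`!%:R).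
  rewrite /C; case: n => [|n]; first by rewrite /= mul1n subr0 partition_sum0 fact0.
  have M0 : (M n.+1)%:R != 0 :> rat := expQ_M_neq0 Q n.+1.
  have sigmaE : 1 - (m n.+1)%:~R = (M n.+1)%:R * partition_sum (block_weight Q I) n.+1.
    exact: m_restr_sum.
  have [sigma1 _] := block_weight_inv Q I (ltn0Sn n).
  rewrite -[expQ_M Q]/M in sigma1.
  set S := partition_sum _ _ in sigmaE sigma1 *; set c := m n.+1 in sigmaE *.
  have f0 := fact_neq0 n.+1; rewrite natrM.
  apply: (mulfI M0); have -> : (M n.+1)%:R * (s%:R ^+ n.+1 * (S / (n.+1)`!%:R)) =
    s%:R ^+ n.+1 * ((M n.+1)%:R * S) / (n.+1)`!%:R by ring.
  case: ifP => [_|/negbT].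
    by rewrite -sigmaE; field; rewrite M0 f0.
  by rewrite /= negbK => /sigma1 ->; field; rewrite M0 f0.
(* [E] is the derivative of [B(s x)/s], and [D] is the exponential of that series; hence [D' = E D],
   while [C' = s E C]. *)
pose E : fps := fun k => s%:R ^+ k * block_weight Q I k.+1 / k`!%:R.
pose D : fps := fun k => partition_sum (enriched_weight gT Q I) k / k`!%:R.
have powE : fps_pow C s%:R^-1 =1 D.
  apply: (fps_pow_exp (s := s%:R) (E := E)).
  - by rewrite defC expr0 mul1r partition_sum0 fact0 divr1.
  - by rewrite /D partition_sum0 fact0 divr1.
  - exact: mulVf.
  - move=> n; rewrite defC mulrCA partition_sum_ode exprS -mulrA; congr (_ * _).
    rewrite /fps_mul mulr_sumr; apply: eq_bigr => i _; rewrite defC /E.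
    have lein : (i <= n)%N by rewrite -ltnS.
    rewrite -{1}(subnKC lein) exprD; ring.
  - move=> n; rewrite partition_sum_ode; apply: eq_fps_mul => // k _.
    by rewrite /E /enriched_weight s_def.
apply: fps_div_eq => [|n]; first by rewrite powE /D partition_sum0 fact0 divr1 oner_eq0.
have N0 k : (N k)%:R != 0 :> rat := expR_N_neq0 R k.
have numerE : numer n = - (dowling_sum R I J n / n`!%:R).
  have sumE : 1 - (p n)%:~R = (N n)%:R * dowling_sum R I J n by apply: p_restr_sum.
  have [sum1 _] := zero_weight_inv R I J n; rewrite -[expR_N R]/N in sum1.
  have f0 := fact_neq0 n; apply: (mulfI (N0 n)); rewrite /numer mulrN mulrA natrM.
  case: ifP => [_|/negbT].
    by rewrite -sumE; field; rewrite N0 f0.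
  by rewrite negbK => /sum1 ->; field; rewrite N0 f0.
(* The Dowling sums are the convolution of the zero-block weights with [D]; those weights are minus
   the wanted coefficients, which absorbs the sign of the numerator. *)
rewrite numerE /dowling_sum binomial_conv -sumrN; apply: eq_bigr => k _.
rewrite powE -mulNr; congr (_ * _).
rewrite /zero_weight /top_weightR /mu /mu_restr.
case: ifP => _; rewrite ?oppr0 ?mul0r ?oppr0 //.
rewrite natrM; field; by rewrite N0 fact_neq0.
Qed.
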